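(* Let $(M,\xi,\lambda,g)$ be a compact and connected $n$-dimensional almost Ricci soliton ($n>2$) whose potential vector field $\xi$ is affine conformal Killing, i.e. $$\mathcal L_{\xi}\nabla=d\rho\otimes I+I\otimes d\rho-g\otimes\nabla\rho$$ for a smooth function $\rho$ on $M$. Let $r$ be the scalar curvature of $(M,g)$. If $r\neq 0$ and $$r(n\lambda-r)\leq 0,$$ then $\xi$ is an affine Killing vector field and the manifold is a trivial Ricci soliton.
   Context: $(M,g)$ is a Riemannian manifold with Levi-Civita connection $\nabla$; $\nabla\rho$ is the gradient of $\rho$. The displayed condition on $\xi$ means $(\mathcal L_{\xi}\nabla)(X,Y)=X(\rho)Y+Y(\rho)X-g(X,Y)\nabla\rho$ for all vector fields $X,Y$. $(M,\xi,\lambda,g)$ is an almost Ricci soliton if $\lambda$ is a smooth function on $M$ and $\frac12\mathcal L_{\xi}g+\operatorname{Ric}=\lambda g$; it is a Ricci soliton if $\lambda$ is constant, and it is trivial if its potential vector field $\xi$ is Killing, i.e. $\mathcal L_\xi g=0$. A vector field $\xi$ is affine Killing if $\mathcal L_\xi\nabla=0$. The conditions on $r$ and $\lambda$ are understood at every point of $M$. *)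

(* Defs.v *)
(* MathComp-Analysis *)
From HB Require Import structures.
From mathcomp Require Import all_boot all_order all_algebra.
From mathcomp Require Import all_classical all_reals all_analysis.
From mathcomp Require Import ring.

Set Implicit Arguments.
Unset Strict Implicit.
Unset Printing Implicit Defensive.

Import Order.TTheory GRing.Theory Num.Theory.
Import numFieldNormedType.Exports.

Local Open Scope classical_set_scope.
Local Open Scope ring_scope.

Section SmoothOn.
Context {R : realType} {n : nat}.
Implicit Types (U : set 'rV[R]_n) (f g : 'rV[R]_n -> R).

(* Only meant for open U, where f is allowed to take junk values outside U. *)
Fixpoint Ck (k : nat) U f : Prop :=
  {within U, continuous f} /\
  if k is k'.+1 then
    forall i : 'I_n,
      (forall x, U x -> derivable f x (delta_mx 0 i)) /\
      Ck k' U (fun x => 'D_(delta_mx 0 i) f x)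
  else True.

Definition smooth_on U f : Prop := forall k, Ck k U f.

Lemma Ck_continuous k U f : Ck k U f -> {within U, continuous f}.
Proof. by case: k => [|k] []. Qed.

Lemma CkS k U f : Ck k.+1 U f -> Ck k U f.
Proof.
elim: k f => [|k IH] f /=; first by case.
by case=> cf df; split=> // i; have [? ?] := df i; split=> //; exact: IH.
Qed.

Lemma eq_Ck k U f g : open U -> (forall x, U x -> f x = g x) ->
  Ck k U f -> Ck k U g.
Proof.
move=> oU; elim: k f g => [|k IH] f g fg.
  case=> cf _; split=> //.
  by apply: subspace_eq_continuous cf => x; rewrite inE => /fg.
case=> cf df; split.
  by apply: subspace_eq_continuous cf => x; rewrite inE => /fg.
have nfg x : U x -> {near x, f =1 g}.
  by move=> Ux; near=> y; apply: fg; near: y; exact: open_nbhs_nbhs.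
move=> i; have [dfi Cfi] := df i.
split=> [x Ux|].
  exact: near_eq_derivable (nfg _ Ux) (dfi _ Ux).
apply: IH Cfi => x Ux; exact: near_eq_derive _ (nfg _ Ux).
Unshelve. all: end_near. Qed.

Lemma Ck_cst k U (c : R) : open U -> Ck k U (fun=> c).
Proof.
move=> oU; elim: k c => [|k IH] c /=.
  by split=> //; apply: continuous_subspaceT => x; exact: cst_continuous.
split; first by apply: continuous_subspaceT => x; exact: cst_continuous.
move=> i; split=> [x _|]; first exact: derivable_cst.
by apply: eq_Ck (IH 0) => // x Ux; rewrite derive_cst.
Qed.

Lemma Ck_add k U f g : open U -> Ck k U f -> Ck k U g -> Ck k U (f + g).
Proof.
move=> oU; elim: k f g => [|k IH] f g [cf df] [cg dg]; split=> //.
- by move=> x; apply: cvgD; [exact: cf|exact: cg].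
- by move=> x; apply: cvgD; [exact: cf|exact: cg].
- move=> i; have [dfi Cfi] := df i; have [dgi Cgi] := dg i; split=> [x Ux|].
    by apply: derivableD; [exact: dfi|exact: dgi].
  apply: eq_Ck (IH _ _ Cfi Cgi) => // x Ux.
  by rewrite deriveD; [|exact: dfi|exact: dgi].
Qed.

Lemma Ck_mul k U f g : open U -> Ck k U f -> Ck k U g -> Ck k U (f * g).
Proof.
move=> oU; elim: k f g => [|k IH] f g Cf Cg; split=> //.
- by move=> x; apply: cvgM; [exact: Ck_continuous Cf x|exact: Ck_continuous Cg x].
- by move=> x; apply: cvgM; [exact: Ck_continuous Cf x|exact: Ck_continuous Cg x].
- move=> i; have [_ df] := Cf; have [_ dg] := Cg.
  have [dfi Cfi] := df i; have [dgi Cgi] := dg i; split=> [x Ux|].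
    by apply: derivableM; [exact: dfi|exact: dgi].
  apply: eq_Ck (Ck_add oU (IH _ _ (CkS Cf) Cgi) (IH _ _ (CkS Cg) Cfi)) => // x Ux.
  by rewrite deriveM; [|exact: dfi|exact: dgi].
Qed.

End SmoothOn.

Record chart (R : realType) (n : nat) (M : topologicalType) := Chart {
  cdom : set M;
  ccod : set 'rV[R]_n;
  coord : M -> 'rV[R]_n;
  param : 'rV[R]_n -> M;
  open_cdom : open cdom;
  open_ccod : open ccod;
  coord_ccod : forall p, cdom p -> ccod (coord p);
  param_cdom : forall x, ccod x -> cdom (param x);
  coordK : forall p, cdom p -> param (coord p) = p;
  paramK : forall x, ccod x -> coord (param x) = x;
  coord_continuous : {within cdom, continuous coord};
  param_continuous : {within ccod, continuous param}
}.

Arguments open_cdom {R n M} c.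
Arguments open_ccod {R n M} c.

(* The atlas need not be maximal: the smooth functions, and with them every
   notion below, are those of the maximal atlas that contains it. *)
Record smoothManifold (R : realType) (n : nat) := SmoothManifold {
  carrier :> topologicalType;
  hausdorff_carrier : hausdorff_space carrier;
  second_countable_carrier : @second_countable carrier;
  atlas : set (chart R n carrier);
  atlas_cover : forall p, exists2 c, atlas c & cdom c p;
  atlas_compatible : forall c c', atlas c -> atlas c' ->
    forall i : 'I_n,
      smooth_on (ccod c `&` param c @^-1` cdom c')
        (fun x => coord c' (param c x) 0 i)
}.

Section SmoothFunctions.
Context {R : realType} {n : nat} (M : smoothManifold R n).

Definition smooth : {pred M -> R} :=
  fun f => `[< forall c, atlas c -> smooth_on (ccod c) (f \o param c) >].

Lemma smooth_cst (c : R) : (fun=> c) \in smooth.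
Proof. by apply/asboolP => d _ k; exact: Ck_cst (open_ccod d). Qed.

Lemma smooth_add f g : f \in smooth -> g \in smooth -> f + g \in smooth.
Proof.
move=> /asboolP sf /asboolP sg; apply/asboolP => c Ac k.
exact: Ck_add (open_ccod c) (sf c Ac k) (sg c Ac k).
Qed.

Lemma smooth_mul f g : f \in smooth -> g \in smooth -> f * g \in smooth.
Proof.
move=> /asboolP sf /asboolP sg; apply/asboolP => c Ac k.
exact: Ck_mul (open_ccod c) (sf c Ac k) (sg c Ac k).
Qed.

Lemma smooth_subring : subring_closed smooth.
Proof.
split=> [|f g sf sg|]; [exact: smooth_cst 1| |exact: smooth_mul].
rewrite -(mulN1r g); apply/smooth_add/smooth_mul => //.
exact: smooth_cst (-1).
Qed.

(* The ring C^oo(M). *)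
Record smooth_fun := SmoothFun { sfun :> M -> R; _ : sfun \in smooth }.

HB.instance Definition _ := [isSub for sfun].
HB.instance Definition _ := [Choice of smooth_fun by <:].
HB.instance Definition _ :=
  GRing.SubChoice_isSubComPzRing.Build _ _ smooth_fun smooth_subring.

Definition sfun_cst (c : R) : smooth_fun := SmoothFun (smooth_cst c).

End SmoothFunctions.

Section VectorFields.
Context {R : realType} {n : nat} (M : smoothManifold R n).
Local Notation C := (smooth_fun M).

Definition derivation (X : C -> C) : Prop :=
  [/\ forall f g, X (f + g) = X f + X g,
      forall (c : R) f, X (sfun_cst M c * f) = sfun_cst M c * X f
    & forall f g, X (f * g) = X f * g + f * X g].

(* The codomain is the C^oo(M)-module C^oo(M)^o, so that the functions below
   form a C^oo(M)-module, with the pointwise operations. *)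
Definition derivations : {pred C -> C^o} := fun X => `[< derivation X >].

Lemma derivations_submod : submod_closed derivations.
Proof.
split=> [|a X Y /asboolP[XD Xc XM] /asboolP[YD Yc YM]].
  apply/asboolP; split=> [f g|c f|f g] /=.
  - exact: esym (addr0 _).
  - exact: esym (mulr0 _).
  - by rewrite mul0r mulr0 addr0.
apply/asboolP; split=> [f g|c f|f g].
- change (a * X (f + g) + Y (f + g) = (a * X f + Y f) + (a * X g + Y g)).
  by rewrite XD YD mulrDr addrACA.
- change (a * X (sfun_cst M c * f) + Y (sfun_cst M c * f) =
          sfun_cst M c * (a * X f + Y f)).
  by rewrite Xc Yc mulrDr mulrCA.
- change (a * X (f * g) + Y (f * g) = (a * X f + Y f) * g + f * (a * X g + Y g)).
  by rewrite XM YM !mulrDr mulrDl -!mulrA [f * (a * _)]mulrCA addrACA.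
Qed.

(* Smooth vector fields, as derivations of C^oo(M): X f is the derivative of f
   along X.  On a Hausdorff second countable manifold every derivation comes
   from a unique smooth section of the tangent bundle. *)
Record vector_field := VectorField {
  vfun :> C -> C^o;
  _ : vfun \in derivations
}.

HB.instance Definition _ := [isSub for vfun].
HB.instance Definition _ := [Choice of vector_field by <:].
HB.instance Definition _ :=
  GRing.SubChoice_isSubLmodule.Build _ _ _ vector_field
    (GRing.submod_closed_semi derivations_submod).

Lemma bracket_derivation (X Y : vector_field) :
  (fun f : C => X (Y f) - Y (X f) : C^o) \in derivations.
Proof.
case: X Y => [X /asboolP[XD Xc XM]] [Y /asboolP[YD Yc YM]] /=.
apply/asboolP; split=> [f g|c f|f g].
- by rewrite YD !XD YD opprD addrACA.
- by rewrite Yc !Xc Yc -mulrBr.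
- change (X (Y (f * g)) - Y (X (f * g)) =
     (X (Y f) - Y (X f)) * g + f * (X (Y g) - Y (X g))).
  rewrite YM XM XD YD !XM !YM; ring.
Qed.

Definition bracket (X Y : vector_field) : vector_field :=
  VectorField (bracket_derivation X Y).

End VectorFields.

Section RiemannianGeometry.
Context {R : realType} {n : nat} (M : smoothManifold R n).
Local Notation C := (smooth_fun M).
Local Notation VF := (vector_field M).

(* A smooth (0,2)-tensor field is a C^oo(M)-bilinear map on vector fields.  In
   the last clause the conclusion says that the tangent vector X_p is 0. *)
Record riemannian_metric := RiemannianMetric {
  metric :> VF -> VF -> C;
  metricC : forall X Y, metric X Y = metric Y X;
  metricDl : forall X Y Z, metric (X + Y) Z = metric X Z + metric Y Z;
  metricZl : forall f X Y, metric (f *: X) Y = f * metric X Y;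
  metric_ge0 : forall X p, 0 <= metric X X p;
  metric_definite : forall X p, metric X X p = 0 -> forall f : C, X f p = 0
}.

Record affine_connection := AffineConnection {
  conn :> VF -> VF -> VF;
  connDl : forall X Y Z, conn (X + Y) Z = conn X Z + conn Y Z;
  connZl : forall f X Y, conn (f *: X) Y = f *: conn X Y;
  connDr : forall X Y Z, conn X (Y + Z) = conn X Y + conn X Z;
  connZr : forall f X Y, conn X (f *: Y) = (X f : C) *: Y + f *: conn X Y
}.

Variables (g : riemannian_metric) (nabla : affine_connection).

Definition levi_civita : Prop :=
  (forall X Y : VF, nabla X Y - nabla Y X = bracket X Y) /\
  (forall X Y Z : VF, X (g Y Z) = g (nabla X Y) Z + g Y (nabla X Z)).

Definition is_gradient (f : C) (N : VF) : Prop := forall X : VF, g N X = X f.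

Definition curvature (X Y Z : VF) : VF :=
  nabla X (nabla Y Z) - nabla Y (nabla X Z) - nabla (bracket X Y) Z.

Definition orthonormal_at (p : M) (E : 'I_n -> VF) : Prop :=
  forall i j, g (E i) (E j) p = (i == j)%:R.

(* The fields need not be orthonormal away from p, so that such a family
   exists at every point; the traces below do not depend on the choice, since
   they are traces of tensors. *)
Definition onb (p : M) : 'I_n -> VF :=
  xget (fun=> 0) [set E | orthonormal_at p E].

(* Ric(Y, Z) = tr (X |-> R(X, Y) Z). *)
Definition ricci (Y Z : VF) (p : M) : R :=
  \sum_(i < n) g (curvature (onb p i) Y Z) (onb p i) p.

Definition scalar_curvature (p : M) : R :=
  \sum_(i < n) ricci (onb p i) (onb p i) p.

Definition lie_metric (xi X Y : VF) : C :=
  (xi (g X Y) : C) - g (bracket xi X) Y - g X (bracket xi Y).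

Definition lie_connection (xi X Y : VF) : VF :=
  bracket xi (nabla X Y) - nabla (bracket xi X) Y - nabla X (bracket xi Y).

Definition killing (xi : VF) : Prop := forall X Y, lie_metric xi X Y = 0.

Definition affine_killing (xi : VF) : Prop :=
  forall X Y, lie_connection xi X Y = 0.

Definition affine_conformal_killing (xi : VF) : Prop :=
  exists rho : C, exists2 N : VF, is_gradient rho N &
    forall X Y, lie_connection xi X Y =
      (X rho : C) *: Y + (Y rho : C) *: X - g X Y *: N.

Definition almost_ricci_soliton (xi : VF) (lambda : C) : Prop :=
  forall X Y p,
    2^-1 * lie_metric xi X Y p + ricci X Y p = lambda p * g X Y p.

Definition ricci_soliton (xi : VF) (lambda : C) : Prop :=
  almost_ricci_soliton xi lambda /\ exists c : R, forall p, lambda p = c.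

Definition trivial_ricci_soliton (xi : VF) (lambda : C) : Prop :=
  ricci_soliton xi lambda /\ killing xi.

End RiemannianGeometry.

(* Main.v *)
From HB Require Import structures.
Require Import Defs.
From mathcomp Require Import all_boot all_order all_algebra.
From mathcomp Require Import all_classical all_reals all_analysis.
From mathcomp Require Import ring lra.

(** The proof applies the maximum principle to lambda.  Write S for the Ricci
    tensor, s for its trace, h = L_xi g = 2 (lambda g - S), and N for the gradient
    of rho.

    Up to a curvature term, L_xi nabla is the second covariant derivative of xi;
    as the curvature is skew, L_xi nabla determines nabla h, and the condition on
    xi becomes nabla S = d(lambda - rho) (x) g (nabla_ricci).  Contracted twice,
    the second Bianchi identity then forces (n - 2) d(lambda - rho) = 0
    (derive_lam_rho): S is parallel and d rho = d lambda.  The Lie derivative of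
    the curvature is the exterior covariant derivative of L_xi nabla.  Its trace
    is L_xi S = - (n - 2) Hess rho - (Delta rho) g (lie_ricci), and one more trace
    gives |S|^2 = lambda s + (n - 1) Delta rho (norm_ricci).

    At a maximum p of lambda, Delta rho = Delta lambda <= 0, so that
    |S|^2 <= lambda s <= s^2 / n by hypothesis.  This is the equality case of the
    Cauchy-Schwarz inequality, so S = c g at p, where c = lambda p
    (einstein_at_max).  Both tensors are parallel and M is connected, hence
    S = c g everywhere and s = n c is a nonzero constant (einstein).  If c < 0,
    the hypothesis on s says lambda >= c, while c is the maximum of lambda.  If
    c > 0, the function mu = c - lambda solves Obata's equation
    Hess mu = - k mu g with k = c / (n - 1) (einstein_hess), so that
    |N|^2 + k mu^2 is constant; it vanishes at p, hence everywhere.  In both cases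
    lambda = c, N = 0 and h = 0, which is the claim.

    Vector fields being derivations of C^oo(M), the tools of this argument rest on
    one local fact: by Hadamard's lemma, and after a cutoff by a bump function, a
    derivation is near each point a combination of the n coordinate fields of a
    chart (frame_expand).  Hence n orthonormal fields span (parseval),
    derivations commute with traces taken in arbitrary pointwise frames
    (derive_trace), first and second derivatives at a maximum have the usual
    signs (maximum_conditions), and a parallel tensor that vanishes at a point
    vanishes, by Gronwall's inequality (parallel_vanish).  Orthonormal frames
    exist at every point because s is nonzero there (onb_orthonormal). *)

Set Implicit Arguments.
Unset Strict Implicit.
Unset Printing Implicit Defensive.

Import Order.TTheory GRing.Theory Num.Theory.
Import numFieldNormedType.Exports.

Local Open Scope classical_set_scope.
Local Open Scope ring_scope.

Local Notation coord := Defs.coord.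

(** * Functions of class C^k *)

Section Calculus.
Context {R : realType} {n : nat}.
Implicit Types (U V : set 'rV[R]_n) (f g : 'rV[R]_n -> R) (x v : 'rV[R]_n).
Local Notation e := (delta_mx 0).

Lemma Ck_at k U f x : open U -> Ck k U f -> U x -> {for x, continuous f}.
Proof.
move=> oU /Ck_continuous cf Ux.
by move: cf; rewrite (continuous_open_subspace f oU); apply; rewrite inE.
Qed.

Lemma Ck_local k U f : open U ->
  (forall x, U x -> exists V, [/\ open V, V x & Ck k V f]) -> Ck k U f.
Proof.
move=> oU; elim: k f => [|k IH] f loc.
  split=> //; rewrite (continuous_open_subspace f oU) => x /[!inE] Ux.
  by have [V [oV Vx CV]] := loc x Ux; exact: Ck_at CV Vx.
split.
  rewrite (continuous_open_subspace f oU) => x /[!inE] Ux.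
  by have [V [oV Vx CV]] := loc x Ux; exact: Ck_at CV Vx.
move=> i; split=> [x Ux|].
  by have [V [oV Vx [_ CV]]] := loc x Ux; have [/(_ x Vx)] := CV i.
apply: IH => x Ux; have [V [oV Vx [_ CV]]] := loc x Ux.
by exists V; split=> //; have [_] := CV i.
Qed.

Lemma Ck_sub k U V f : open U -> open V -> V `<=` U -> Ck k U f -> Ck k V f.
Proof.
move=> oU oV VU; elim: k f => [|k IH] f [cf df]; split=> //.
- exact: continuous_subspaceW cf.
- exact: continuous_subspaceW cf.
- by move=> i; have [di Ci] := df i; split=> [x /VU/di //|]; exact: IH.
Qed.

Lemma is_derive_line f x v (t : R) : derivable f (t *: v + x) v ->
  is_derive t (1 : R) (fun s : R => f (s *: v + x)) ('D_v f (t *: v + x)).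
Proof.
move=> df.
have E : (fun h : R => h^-1 *: (f (h *: v + (t *: v + x)) - f (t *: v + x))) =
  (fun h : R => h^-1 *: (f ((h *: (1 : R) + t) *: v + x) - f (t *: v + x))).
  by apply/funext => h; rewrite scalerDl addrA /GRing.scale /= mulr1.
apply: DeriveDef; first by move: df; rewrite /derivable /= E.
by rewrite /derive /= E.
Qed.

Lemma derive_line (W : normedModType R) (h : 'rV[R]_n -> W) x v :
  'D_v h x = 'D_1 (fun t : R => h (t *: v + x)) 0.
Proof.
rewrite /derive; set g1 := fun a => a^-1 *: _; set g2 := fun a => a^-1 *: _.
suff -> : g1 = g2 by [].
by rewrite funeqE /g1 /g2 => a /=; rewrite addr0 scale0r add0r [_%:A]mulr1.
Qed.

Lemma is_derive_of_line f x v (d : R) :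
  is_derive (0 : R) (1 : R) (fun t : R => f (t *: v + x)) d ->
  is_derive x v f d.
Proof.
by case=> df E; apply: DeriveDef; [exact/derivable1P|rewrite derive_line].
Qed.

Lemma line_MVT f x v (a : R) :
  (forall t : R, `|t| <= `|a| -> derivable f (t *: v + x) v) ->
  exists2 t : R, `|t| <= `|a| & f (a *: v + x) - f x = a * 'D_v f (t *: v + x).
Proof.
move=> df.
have D (t : R) : `|t| <= `|a| ->
    is_derive t (1 : R) (fun s : R => f (s *: v + x)) ('D_v f (t *: v + x)).
  by move=> /df; exact: is_derive_line.
have C (u w : R) : (forall t, t \in `[u, w]%R -> `|t| <= `|a|) ->
    {within `[u, w], continuous (fun s : R => f (s *: v + x))}.
  move=> uw; apply: derivable_within_continuous => t /uw ta.
  by have [] := D t ta.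
have [a0|a0] := leP 0 a.
- have Ia (t : R) : t \in `[0, a]%R -> `|t| <= `|a|.
    by rewrite in_itv /= => /andP[t0 ta]; rewrite !ger0_norm.
  have [||t ta] := @MVT_segment R (fun s => f (s *: v + x))
      (fun t => 'D_v f (t *: v + x)) 0 a a0.
  + by move=> t /subset_itv_oo_cc /Ia; exact: D.
  + exact: C.
  rewrite scale0r add0r subr0 => E; exists t; first exact: Ia.
  by rewrite E mulrC.
- have Ia (t : R) : t \in `[a, 0]%R -> `|t| <= `|a|.
    rewrite in_itv /= => /andP[t0 ta].
    by rewrite (ler0_norm ta) (ler0_norm (ltW a0)) lerN2.
  have [||t ta] := @MVT_segment R (fun s => f (s *: v + x))
      (fun t => 'D_v f (t *: v + x)) a 0 (ltW a0).
  + by move=> t /subset_itv_oo_cc /Ia; exact: D.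
  + exact: C.
  rewrite scale0r add0r sub0r => E; exists t; first exact: Ia.
  by rewrite -opprB E mulrN opprK mulrC.
Qed.

Lemma rV_coord_continuous i : continuous (fun x : 'rV[R]_n => x 0 i).
Proof. exact: coord_continuous. Qed.

Definition rV_cball x (r : R) : set 'rV[R]_n := [set y | `|y - x| <= r].

Lemma closed_rV_cball x r : closed (rV_cball x r).
Proof.
rewrite /rV_cball (_ : [set y | _] =
  (fun y : 'rV[R]_n => `|y - x|) @^-1` [set t : R | t <= r]) //.
apply: closed_comp (@closed_le R r) => y _.
apply: (@continuous_comp _ _ _ (fun y : 'rV[R]_n => y - x) (fun y => `|y|)).
  by apply: continuousB; [exact: id|exact: cst_continuous].
exact: norm_continuous.
Qed.

Lemma compact_rV_cball x r : compact (rV_cball x r).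
Proof.
apply: bounded_closed_compact; last exact: closed_rV_cball.
exists (r + `|x|); split; first exact: num_real.
move=> s rs y /= yr; rewrite (le_trans _ (ltW rs)) //.
by rewrite -{1}(subrK x y) (le_trans (ler_normD _ _)) // lerD2r.
Qed.

Lemma norm_rV_le x (r : R) : 0 <= r ->
  (forall i, `|x 0 i| <= r) -> `|x| <= r.
Proof.
move=> r0 xr; rewrite [leLHS]/Num.Def.normr/= mx_normrE.
by apply: bigmax_le => // -[i j] _; rewrite /= (ord1 i).
Qed.

Lemma norm_rV_ge x i : `|x 0 i| <= `|x|.
Proof.
rewrite [leRHS]/Num.Def.normr/= mx_normrE.
exact: (le_bigmax _ (fun ij => `|x ij.1 ij.2|) (0, i)).
Qed.

End Calculus.

Section Differentiability.
Context {R : realType} {n : nat}.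
Implicit Types (U V : set 'rV[R]_n) (f g : 'rV[R]_n -> R) (x v : 'rV[R]_n).
Local Notation e := (delta_mx 0).

Let lin (a : 'I_n -> R) (v : 'rV[R]_n) : R := \sum_i v 0 i * a i.

Let lin_is_linear a : linear (lin a).
Proof.
move=> c u v; rewrite /lin scaler_sumr -big_split; apply: eq_bigr => i _.
by rewrite !mxE mulrDl -mulrA.
Qed.

HB.instance Definition _ a := GRing.isLinear.Build R _ R *:%R (lin a)
  (lin_is_linear a).

Let lin_continuous a : continuous (lin a).
Proof.
rewrite /lin; apply: continuous_big => [|i _ x]; first exact: add_continuous.
apply: (@continuousM _ _ (fun y : 'rV[R]_n => y 0 i) (fun=> a i)).
  exact: rV_coord_continuous.
exact: cst_continuous.
Qed.

Let lower (k : nat) v : 'rV[R]_n := \row_i (if (i < k)%N then v 0 i else 0).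

Let lower0 v : lower 0 v = 0.
Proof. by apply/rowP => i; rewrite !mxE. Qed.

Let lower_full v : lower n v = v.
Proof. by apply/rowP => i; rewrite !mxE ltn_ord. Qed.

Let lowerS (i : 'I_n) v : lower i.+1 v = v 0 i *: e i + lower i v.
Proof.
apply/rowP => j; rewrite !mxE eqxx /= ltnS leq_eqVlt.
have [->|ji] := eqVneq j i; first by rewrite eqxx ltnn mulr1 addr0.
by rewrite -val_eqE in ji; rewrite (negbTE ji) mulr0 add0r.
Qed.

Let near_lower x v (i : 'I_n) (t r : R) : `|v| <= r -> `|t| <= `|v 0 i| ->
  `|t *: e i + (lower i v + x) - x| <= r.
Proof.
move=> vr tv; rewrite addrA addrK; apply: norm_rV_le.
  exact: le_trans (normr_ge0 v) vr.
move=> j; rewrite !mxE eqxx /=.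
have vj k : `|v 0 k| <= r by exact: le_trans (norm_rV_ge v k) vr.
have [->|ji] := eqVneq j i.
  by rewrite ltnn mulr1 addr0 (le_trans tv).
rewrite mulr0 add0r; case: ifP => // _.
by rewrite normr0 (le_trans (normr_ge0 v)).
Qed.

(** The increment of f is split along the coordinate directions, and the mean
    value theorem applies on each edge of the path; the continuity of the
    partial derivatives makes the error uniformly small. *)
Lemma partial_littleo U f x : open U -> Ck 1 U f -> U x ->
  f \o shift x =
    (cst (f x) : 'rV[R]_n -> R^o) + lin (fun i => 'D_(e i) f x)
      +o_ (0 : 'rV[R]_n) id.
Proof.
move=> oU Cf Ux; apply/eqaddoP => _/posnumP[eps].
pose d := eps%:num / n.+1%:R.
have d0 : 0 < d by rewrite divr_gt0.
have [r /= r0 xr] : exists2 r : R, 0 < r & forall y, `|y - x| < r -> U y /\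
    forall i, `|'D_(e i) f y - 'D_(e i) f x| <= d.
  have : \forall y \near x, U y /\
      forall i, `|'D_(e i) f y - 'D_(e i) f x| <= d.
    apply: filterI; first exact: open_nbhs_nbhs.
    apply: (filter_forall (nbhs_filter x)) => i; have [_ /(_ i)[_ Ci]] := Cf.
    have /cvgrPdist_le /(_ d d0) := Ck_at oU (Ci : Ck 0 U _) Ux.
    by apply: filterS => y; rewrite distrC.
  move=> /nbhs_ballP[r r0 xr]; exists r => // y yx.
  by apply: xr; rewrite -ball_normE /= distrC.
have near0 : \forall h \near (0 : 'rV[R]_n), `|h| < r.
  apply/nbhs_ballP; exists r => // y.
  by rewrite -ball_normE /= sub0r normrN.
apply: filterS near0 => h hr.
have -> : (f \o shift x - (cst (f x) + lin (fun i => 'D_(e i) f x))) h =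
    \sum_(i < n) (f (lower i.+1 h + x) - f (lower i h + x)
      - h 0 i * 'D_(e i) f x).
  rewrite sumrB !fctE /= /lin opprD addrA; congr (_ - _).
  rewrite -(big_mkord xpredT (fun i => f (lower i.+1 h + x) - f (lower i h + x))).
  by rewrite telescope_sumr // lower0 add0r lower_full.
apply: (le_trans (ler_norm_sum _ _ _)).
apply: (@le_trans _ _ (\sum_(i < n) `|h| * d)); last first.
  rewrite sumr_const card_ord -mulr_natr -mulrA [leRHS]mulrC ler_wpM2l //.
  by rewrite /d -mulrA ger_pMr // mulrC ler_pdivrMr // mul1r ler_nat.
apply: ler_sum => i _.
have [t th ->] : exists2 t : R, `|t| <= `|h 0 i| &
   f (lower i.+1 h + x) - f (lower i h + x) =
   h 0 i * 'D_(e i) f (t *: e i + (lower i h + x)).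
  rewrite lowerS -addrA; apply: line_MVT => t th.
  have [_ /(_ i)[+ _]] := Cf; apply.
  by have [] := xr _ (le_lt_trans (near_lower _ (lexx _) th) hr).
rewrite -mulrBr normrM ler_pM ?norm_rV_ge //.
by have [_] := xr _ (le_lt_trans (near_lower _ (lexx _) th) hr); apply.
Qed.

Lemma C1_differentiable U f x : open U -> Ck 1 U f -> U x ->
  differentiable f x.
Proof.
move=> oU Cf Ux; have E := partial_littleo oU Cf Ux.
apply/diff_locallyP; rewrite (diff_unique (@lin_continuous _) E).
by split; first exact: lin_continuous.
Qed.

Lemma C1_derive U f x v : open U -> Ck 1 U f -> U x ->
  'D_v f x = \sum_i v 0 i * 'D_(e i) f x.
Proof.
move=> oU Cf Ux; rewrite deriveE; last exact: C1_differentiable Cf Ux.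
by rewrite (diff_unique (@lin_continuous _) (partial_littleo oU Cf Ux)).
Qed.

End Differentiability.

Section Composition.
Context {R : realType} {m n : nat}.
Implicit Types (U : set 'rV[R]_m) (V : set 'rV[R]_n).
Implicit Types (f : 'rV[R]_n -> R) (phi : 'rV[R]_m -> 'rV[R]_n).
Local Notation e := (delta_mx 0).

(** Restricting phi to the line through x with direction v reduces the claim to
    the chain rule for the differentiable f along a curve. *)
Lemma C1_chain V f phi x v : open V -> Ck 1 V f -> V (phi x) ->
  (forall j, derivable (fun y => phi y 0 j) x v) ->
  is_derive x v (f \o phi)
    (\sum_j 'D_v (fun y => phi y 0 j) x * 'D_(e j) f (phi x)).
Proof.
move=> oV Cf Vx dphi.
have dm : derivable phi x v by apply/derivable_mxP => i j; rewrite (ord1 i).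
have df := C1_differentiable oV Cf Vx.
pose c (t : R) := phi (t *: v + x).
have c0 : c 0 = phi x by rewrite /c scale0r add0r.
have dc : differentiable c 0 by apply/derivable1_diffP; exact: (derivable1P _ _ _).1 dm.
have dfc : differentiable f (c 0) by rewrite c0.
have dcomp : derivable (fun t : R => (f \o phi) (t *: v + x)) 0 1.
  by apply/derivable1_diffP; exact: (@differentiable_comp _ _ _ _ c f).
apply: DeriveDef; first exact/derivable1P.
rewrite derive_line deriveE; last exact/derivable1_diffP.
rewrite (@diff_comp _ _ _ _ c f) //= c0 -deriveE //.
rewrite (C1_derive _ oV Cf Vx).
apply: eq_bigr => j _; congr (_ * _).
have -> : 'd c 0 1 = 'D_v phi x by rewrite -deriveE // derive_line.
by rewrite derive_mx // mxE.
Qed.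

Lemma Ck_le j k V f : (j <= k)%N -> Ck k V f -> Ck j V f.
Proof.
move=> /subnK <-; elim: (k - j)%N => [|d IH]; first by [].
by rewrite addSn => /CkS.
Qed.

Lemma Ck_sum k U (p : nat) (F : 'I_p -> 'rV[R]_m -> R) : open U ->
  (forall i, Ck k U (F i)) -> Ck k U (fun x => \sum_i F i x).
Proof.
move=> oU; elim: p F => [|p IH] F CF.
  by apply: eq_Ck (Ck_cst k 0 oU) => // x _; rewrite big_ord0.
apply: eq_Ck (Ck_add oU (IH (fun i => F (widen_ord (leqnSn p) i)) _)
  (CF ord_max)) => // x _.
by rewrite big_ord_recr.
Qed.

Lemma Ck_comp k U V f phi : open U -> open V -> Ck k V f ->
  (forall x, U x -> V (phi x)) ->
  (forall j, Ck k U (fun x => phi x 0 j)) -> Ck k U (f \o phi).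
Proof.
move=> oU oV; move=> Cf UV Cphi.
have cphi x : U x -> {for x, continuous phi}.
  move=> Ux; apply/(@cvgrPdist_le _ _ _ (nbhs x) (nbhs_filter x)) => r r0.
  have : \forall y \near x, forall j, `|phi x 0 j - phi y 0 j| <= r.
    apply: (filter_forall (nbhs_filter x)) => j.
    by have /cvgrPdist_le := Ck_at oU (Cphi j) Ux; apply.
  apply: filterS => y yx; apply: norm_rV_le; first exact: ltW.
  by move=> j; rewrite !mxE.
have C0 : {in U, continuous (f \o phi)}.
  move=> x /[!inE] Ux; apply: continuous_comp; last first.
    exact: Ck_at Cf (UV _ Ux).
  exact: cphi.
elim: k f Cf Cphi C0 => [|k IH] f Cf Cphi C0.
  by split=> //; rewrite continuous_open_subspace.
split; first by rewrite continuous_open_subspace.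
move=> i; have D x : U x -> is_derive x (e i) (f \o phi)
    (\sum_j 'D_(e i) (fun y => phi y 0 j) x * 'D_(e j) f (phi x)).
  move=> Ux; apply: (@C1_chain V) => //; last first.
  - by move=> j; have [_ /(_ i)[/(_ x Ux)]] := Cphi j.
  - exact: UV.
  - exact: Ck_le Cf.
split=> [x Ux|]; first by have [] := D x Ux.
apply: (@eq_Ck _ _ _ _ (fun x => \sum_j 'D_(e i) (fun y => phi y 0 j) x *
  'D_(e j) f (phi x))) => //.
  by move=> x Ux; have [_ ->] := D x Ux.
apply: Ck_sum => // j; apply: Ck_mul => //.
  by have [_ /(_ i)[]] := Cphi j.
have Cfj : Ck k V (fun x => 'D_(e j) f x) by have [_ /(_ j)[]] := Cf.
apply: (IH (fun y => 'D_(e j) f y)) => //; first by move=> l; exact: CkS.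
move=> x /[!inE] Ux; apply: continuous_comp; last exact: Ck_at Cfj (UV _ Ux).
exact: cphi.
Qed.

End Composition.

(** * Bump functions *)

Section Bump.
Context {R : realType}.

(** Derivatives of exp(-1/t) leave this single function but stay in the span of
    the whole family, which is why the exponent m is a parameter. *)
Definition flat (m : nat) (t : R) : R :=
  if 0 < t then t^-1 ^+ m * expR (- t^-1) else 0.

Lemma flat_gt0 m t : 0 < t -> 0 < flat m t.
Proof. by move=> t0; rewrite /flat t0 mulr_gt0 ?expR_gt0 // exprn_gt0 // invr_gt0. Qed.

Lemma flat_le0 m t : t <= 0 -> flat m t = 0.
Proof. by rewrite /flat ltNge => ->. Qed.

(** With s = 1/t this is exp(s) >= s^(m+1) / (m+1)!; it gives both the continuity
    and the derivative of flat m at 0. *)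
Lemma flat_bound m t : `|flat m t| <= (m.+1)`!%:R * `|t|.
Proof.
have [t0|t0] := leP t 0; first by rewrite flat_le0 // normr0 mulr_ge0.
rewrite !gtr0_norm ?flat_gt0 // /flat t0 expRN ler_pdivrMr ?expR_gt0 //.
have s0 : 0 < t^-1 by rewrite invr_gt0.
have := expR_ge1Dxn m (ltW s0); set s := t^-1 in s0 *.
move=> le; have {le} : s ^+ m.+1 / (m.+1)`!%:R <= expR s.
  by apply: le_trans le; rewrite lerDr.
rewrite ler_pdivrMr ?ltr0n ?fact_gt0 // exprS => le.
rewrite mulrAC -ler_pdivrMr // mulrC -/s.
by rewrite [_`!%:R * _]mulrC.
Qed.

Lemma is_derive_flat m t :
  is_derive t (1 : R) (flat m) (flat m.+2 t - m%:R * flat m.+1 t).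
Proof.
have [t0|t0|->] := ltgtP t 0.
- rewrite !flat_le0 ?ltW // mulr0 subr0.
  apply: (@near_eq_is_derive _ _ _ (cst 0)).
  near=> s; rewrite flat_le0 //; apply: ltW; near: s.
    exact: lt_nbhsl.
- have D : is_derive t (1 : R) ((fun u : R => u ^+ m * expR (- u)) \o GRing.inv)
      (flat m.+2 t - m%:R * flat m.+1 t).
    have A : is_derive t^-1 (1 : R) (fun u : R => u ^+ m) (m%:R *: t^-1 ^+ m.-1 *: 1).
      by apply: DeriveDef; [exact: exprn_derivable|rewrite exp_derive].
    have B : is_derive t^-1 (1 : R) (fun u : R => expR (- u)) (expR (- t^-1) * -1).
      exact: (@is_derive1_comp _ expR -%R).
    have C : is_derive t (1 : R) (@GRing.inv R) (- t ^- 2 *: 1).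
      by apply: is_deriveV; rewrite gt_eqF.
    have [dF vF] := is_derive1_comp (is_deriveM A B) C.
    apply: DeriveDef; [exact: dF|rewrite [LHS]vF].
    rewrite /flat t0 /GRing.scale /= -exprVn; set u := t^-1; set E := expR _.
    by case: (m) => [|k]; rewrite ?expr0 ?succnK ?exprS; ring.
  apply: near_eq_is_derive D.
  near=> s; rewrite /flat /=; suff -> : 0 < s by [].
  by near: s; exact: lt_nbhsr.
- rewrite !flat_le0 // mulr0 subr0.
  (* The difference quotient of flat m at 0 is flat m.+1. *)
  have E : (fun h : R => h^-1 *: (flat m (h *: 1 + 0) - flat m 0)) = flat m.+1.
    apply/funext => h; rewrite addr0 (flat_le0 m (lexx 0)) subr0 /flat.
    rewrite /GRing.scale /= mulr1; case: ifP => _; last by rewrite mulr0.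
    by rewrite mulrA -exprS.
  have L : flat m.+1 h @[h --> (0 : R)^'] --> (0 : R).
    apply/cvgrPdist_le => eps eps0; near=> h.
    rewrite sub0r normrN (le_trans (flat_bound _ _)) //.
    rewrite -ler_pdivlMl ?ltr0n ?fact_gt0 //.
    near: h; apply: dnbhs0_le.
    by rewrite mulr_gt0 // invr_gt0 ltr0n fact_gt0.
  apply: DeriveDef; first by rewrite /derivable E; apply/cvg_ex; exists 0.
  by rewrite /derive E; exact/cvg_lim.
Unshelve. all: end_near. Qed.

Lemma continuous_flat m : continuous (flat m).
Proof.
move=> t; apply: differentiable_continuous; apply/derivable1_diffP.
by have [] := is_derive_flat m t.
Qed.

Context {n : nat}.
Implicit Types (x y : 'rV[R]_n).
Local Notation e := (delta_mx 0).

Lemma Ck_flat j m (a s : R) (k : 'I_n) :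
  Ck j setT (fun y : 'rV[R]_n => flat m (a + s * y 0 k)).
Proof.
have oT : open [set: 'rV[R]_n] by exact: openT.
elim: j m => [|j IH] m.
  split=> //; apply: continuous_subspaceT => y.
  apply: (@continuous_comp _ _ _ (fun y : 'rV[R]_n => a + s * y 0 k) (flat m)).
    apply: (@continuousD _ _ _ (fun=> a) (fun y : 'rV[R]_n => s * y 0 k)).
      exact: cst_continuous.
    apply: (@continuousM _ _ (fun=> s) (fun y : 'rV[R]_n => y 0 k)).
      exact: cst_continuous.
    exact: rV_coord_continuous.
  exact: continuous_flat.
have cm := Ck_continuous (IH m).
split=> // i; pose c := s * (i == k)%:R.
have D y : is_derive y (e i) (fun y : 'rV[R]_n => flat m (a + s * y 0 k))
   (c * (flat m.+2 (a + s * y 0 k) - m%:R * flat m.+1 (a + s * y 0 k))).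
  apply: is_derive_of_line.
  have E (t : R) : a + s * (t *: e i + y) 0 k = a + s * y 0 k + t * c.
    by rewrite !mxE eqxx /= eq_sym /c; ring.
  rewrite (_ : (fun t : R => _) = flat m \o (fun t : R => a + s * y 0 k + t * c));
    last by apply/funext => t /=; rewrite E.
  apply: is_derive_eq.
    apply: is_derive1_comp; first exact: is_derive_flat.
  by rewrite mul0r addr0 scaler0 !add0r [_%:A]mulr1 mul1r mulrC.
split=> [y _|]; first by have [] := D y.
apply: (@eq_Ck _ _ _ _
   (cst c * ((fun y : 'rV[R]_n => flat m.+2 (a + s * y 0 k)) +
     cst (- m%:R) * (fun y : 'rV[R]_n => flat m.+1 (a + s * y 0 k))))) => //.
  by move=> y _; have [_ ->] := D y; rewrite !fctE mulNr.
apply: Ck_mul => //; first exact: Ck_cst.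
by apply: Ck_add => //; apply: Ck_mul => //; exact: Ck_cst.
Qed.

(** The two factors bound y_k from below and from above; the coefficients 1 and
    -1 put them in the form of Ck_flat. *)
Definition bump_fun x (r : R) y : R :=
  \prod_(k < n) (flat 0 (r - x 0 k + 1 * y 0 k) * flat 0 (r + x 0 k + -1 * y 0 k)).

Lemma smooth_bump x r : smooth_on setT (bump_fun x r).
Proof.
move=> j; rewrite /bump_fun; move: (openT : open [set: 'rV[R]_n]) => oT.
have : forall (s : seq 'I_n), Ck j setT (fun y : 'rV[R]_n => \prod_(k <- s)
  (flat 0 (r - x 0 k + 1 * y 0 k) * flat 0 (r + x 0 k + -1 * y 0 k))).
  elim=> [|k s IH].
    by apply: eq_Ck (Ck_cst j 1 oT) => // y _; rewrite big_nil.
  apply: eq_Ck (Ck_mul oT (Ck_mul oT (Ck_flat j 0 (r - x 0 k) 1 k)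
    (Ck_flat j 0 (r + x 0 k) (-1) k)) IH) => // y _.
  by rewrite big_cons.
by move/(_ (index_enum _)).
Qed.

Lemma bump_gt0 x r y : `|y - x| < r -> 0 < bump_fun x r y.
Proof.
move=> yx; apply: prodr_gt0 => k _.
have := le_lt_trans (norm_rV_ge (y - x) k) yx; rewrite !mxE ltr_norml => /andP[l u].
by rewrite mulr_gt0 // flat_gt0 //; lra.
Qed.

Lemma bump_eq0 x r y : 0 < r -> r <= `|y - x| -> bump_fun x r y = 0.
Proof.
move=> r0; apply: contraTeq; rewrite -ltNge prodf_seq_neq0 => /allP nz.
rewrite [ltLHS]/Num.Def.normr/= mx_normrE; apply/bigmax_ltP; split=> // -[i k] _.
rewrite /= (ord1 i) !mxE.
have := nz k; rewrite mem_index_enum => /(_ isT) /=.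
rewrite mulf_eq0 negb_or => /andP[A B].
have [a|a] := leP (r - x 0 k + 1 * y 0 k) 0; first by rewrite flat_le0 ?eqxx in A.
have [b|b] := leP (r + x 0 k + -1 * y 0 k) 0; first by rewrite (flat_le0 _ b) eqxx in B.
by rewrite ltr_norml; apply/andP; split; lra.
Qed.

End Bump.

(** * Hadamard's lemma *)

Section ContinuousAlgebra.
Context {R : realType} {T : topologicalType}.
Implicit Types f g : T -> R.

Lemma continuous_mul f g : continuous f -> continuous g ->
  continuous (fun t => f t * g t).
Proof. by move=> cf cg t; apply: cvgM; [exact: cf|exact: cg]. Qed.

Lemma continuous_sub f g : continuous f -> continuous g ->
  continuous (fun t => f t - g t).
Proof. by move=> cf cg t; apply: cvgB; [exact: cf|exact: cg]. Qed.

End ContinuousAlgebra.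

Section UnitIntegral.
Context {R : realType}.
Implicit Types f : R -> R.

Definition int01 f : R := (\int[lebesgue_measure]_(t in `[0%R, 1%R]) f t)%R.

Lemma integrable01 f : continuous f ->
  (@lebesgue_measure R).-integrable `[0%R, 1%R] (EFin \o f).
Proof.
move=> cf; apply: (@continuous_compact_integrable R f).
  exact: segment_compact.
exact: continuous_subspaceT.
Qed.

Lemma int01_cst (c : R) : int01 (fun=> c) = c.
Proof.
rewrite /int01 Rintegral_cst; last exact: measurable_itv.
have E : (@lebesgue_measure R) [set` `[0%R, 1%R]] = 1%:E.
  by rewrite lebesgue_measure_itv /= lte_fin ltr01 oppr0 adde0.
by rewrite -[RHS]mulr1; congr (_ * _); rewrite [X in fine X]E.
Qed.

Lemma int01_bound f (B : R) : continuous f ->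
  (forall t, 0 <= t <= 1 -> `|f t| <= B) -> `|int01 f| <= B.
Proof.
move=> cf fB; rewrite -[leRHS]int01_cst.
apply: le_trans (le_normr_Rintegral _ _) _; first exact: measurable_itv.
  exact: integrable01.
apply: le_Rintegral; first exact: measurable_itv.
- apply: (@integrable01 (fun t => `|f t|)) => t.
  by apply: continuous_comp; [exact: cf|exact: norm_continuous].
- by apply: (@integrable01 (fun=> B)) => t; exact: cst_continuous.
- by move=> t /=; rewrite in_itv /= => /fB.
Qed.

Lemma int01_sum (p : nat) (F : 'I_p -> R -> R) : (forall i, continuous (F i)) ->
  int01 (fun t => \sum_i F i t) = \sum_i int01 (F i).
Proof.
elim: p F => [|p IH] F cF.
  by rewrite big_ord0 -[RHS]int01_cst; congr int01; apply/funext => t; rewrite big_ord0.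
rewrite big_ord_recr -IH //=.
rewrite -[RHS]RintegralD; [|exact: measurable_itv|apply: integrable01|exact: integrable01].
  by congr int01; apply/funext => t; rewrite big_ord_recr.
apply: continuous_big => [|i _]; [exact: add_continuous|exact: cF].
Qed.

Lemma int01B f g : continuous f -> continuous g ->
  int01 (fun t => f t - g t) = int01 f - int01 g.
Proof.
move=> cf cg; apply: RintegralB; first exact: measurable_itv.
  exact: integrable01.
exact: integrable01.
Qed.

Lemma int01Z c f : continuous f -> int01 (fun t => c * f t) = c * int01 f.
Proof.
move=> cf; apply: RintegralZl; first exact: measurable_itv.
exact: integrable01.
Qed.

Lemma int01_derive f f' : (forall t, is_derive t (1 : R) f (f' t)) ->
  continuous f' -> int01 f' = f 1 - f 0.
Proof.
move=> df cf'.
have cf : continuous f.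
  move=> t; apply: differentiable_continuous; apply/derivable1_diffP.
  by have [] := df t.
rewrite /int01 /Rintegral (@continuous_FTC2 _ f' f) //.
- exact: continuous_subspaceT.
- split.
  + by move=> t _; have [] := df t.
  + exact/cvg_at_right_filter/cf.
  + exact/cvg_at_left_filter/cf.
- by move=> t _; rewrite derive1E; have [_ ->] := df t.
Qed.

End UnitIntegral.

Section Hadamard.
Context {R : realType} {n : nat}.
Implicit Types (F : 'rV[R]_n -> R) (x y v : 'rV[R]_n).
Local Notation e := (delta_mx 0).

Definition bounded_support F : Prop := exists r : R, forall y, r < `|y| -> F y = 0.

Let oT : open [set: 'rV[R]_n]. Proof. exact: openT. Qed.

Lemma bounded_support_bounded F : Ck 0 setT F -> bounded_support F ->
  exists2 B : R, 0 <= B & forall y, `|F y| <= B.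
Proof.
move=> CF [r Fr]; pose s := `|r|.
have [|||c _ cmax] := @compact_EVT_max _ R (fun y => `|F y|) (rV_cball 0 s).
- by exists 0; rewrite /rV_cball /= subrr normr0 normr_ge0.
- exact: compact_rV_cball.
- apply: continuous_subspaceT => y; apply: continuous_comp; last exact: norm_continuous.
  exact: (Ck_at oT CF).
exists `|F c| => // y; have [ys|ys] := leP `|y| s.
  by apply: cmax; rewrite inE /rV_cball /= subr0.
by rewrite Fr ?normr0 // (le_lt_trans _ ys) // ler_norm.
Qed.

Lemma bounded_support_derive F i : bounded_support F ->
  bounded_support (fun x => 'D_(e i) F x).
Proof.
move=> [r Fr]; exists r => y yr.
rewrite -[RHS](derive_cst (0 : R) y (e i)).
apply: near_eq_derive.
have : \forall z \near y, r < `|z| 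
  by apply: (@cvgr_gt _ _ (nbhs y) (nbhs_filter y) (fun z : 'rV[R]_n => `|z|) `|y|);
    [exact: norm_continuous|].
by apply: filterS => z zr; rewrite Fr.
Qed.

Lemma Ck1_bounded_lipschitz F : Ck 1 setT F -> bounded_support F ->
  exists2 L : R, 0 <= L & forall y z, `|F y - F z| <= L * `|y - z|.
Proof.
move=> CF bF.
have [B /= B0 FB] : exists2 B : 'I_n -> R, forall i, 0 <= B i &
    forall i y, `|'D_(e i) F y| <= B i.
  have H i : exists B : R, 0 <= B /\ forall y, `|'D_(e i) F y| <= B.
    have [_ /(_ i)[_ Ci]] := CF.
    have [B B0 FB] :=
      bounded_support_bounded (Ci : Ck 0 _ _) (bounded_support_derive i bF).
    by exists B.
  have /choice[B HB] := H.
  by exists B => i; have [] := HB i.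
exists (\sum_i B i); first exact: sumr_ge0.
move=> y z.
have [|t _] := @line_MVT R n F z (y - z) 1.
  by move=> t _; apply: diff_derivable; exact: (C1_differentiable oT CF).
rewrite scale1r subrK mul1r => ->.
rewrite (C1_derive _ oT CF) // mulr_suml (le_trans (ler_norm_sum _ _ _)) //.
apply: ler_sum => i _; rewrite normrM mulrC ler_pM //.
exact: norm_rV_ge.
Qed.

(** The weighted averages over the segment from x to y that form the coefficients
    in Hadamard's lemma.  The weight t^m makes the family stable under partial
    derivatives. *)
Definition radial (m : nat) x F y : R :=
  int01 (fun t => t ^+ m * F (t *: (y - x) + x)).

Lemma continuous_ray F v x : Ck 1 setT F -> continuous (fun t : R => F (t *: v + x)).
Proof.
move=> CF t; apply: differentiable_continuous; apply/derivable1_diffP.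
have D : derivable F (t *: v + x) v.
  by apply: diff_derivable; exact: (C1_differentiable oT CF).
by have [] := is_derive_line D.
Qed.

Let continuous_radial_integrand m F v x : Ck 1 setT F ->
  continuous (fun t : R => t ^+ m * F (t *: v + x)).
Proof.
move=> CF; apply: continuous_mul; last exact: continuous_ray.
exact: exprn_continuous.
Qed.

(** A radial average of a Lipschitz function is Lipschitz. *)
Lemma continuous_radial m x F : Ck 1 setT F -> bounded_support F ->
  continuous (radial m x F).
Proof.
move=> CF bF y.
have [L L0 FL] := Ck1_bounded_lipschitz CF bF.
apply/(@cvgrPdist_le _ _ _ (nbhs y) (nbhs_filter y)) => eps eps0.
have : \forall z \near y, `|y - z| <= eps / (L + 1).
  apply/nbhs_ballP; exists (eps / (L + 1)); first by rewrite /= divr_gt0 // ltr_wpDl.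
  by move=> z; rewrite -ball_normE /= => /ltW.
apply: filterS => z yz.
rewrite /radial -int01B; try exact: continuous_radial_integrand.
apply: int01_bound.
  by apply: continuous_sub; exact: continuous_radial_integrand.
move=> t /andP[t0 t1].
rewrite -mulrBr normrM ger0_norm ?exprn_ge0 //.
apply: (@le_trans _ _ (1 * `|F (t *: (y - x) + x) - F (t *: (z - x) + x)|)).
  by rewrite ler_wpM2r // exprn_ile1.
rewrite mul1r (le_trans (FL _ _)) //.
rewrite opprD addrACA subrr addr0 -scalerBr opprB addrA subrK normrZ ger0_norm //.
apply: (@le_trans _ _ (L * `|y - z|)).
  by rewrite ler_wpM2l // ler_piMl.
apply: (@le_trans _ _ ((L + 1) * `|y - z|)); first by rewrite ler_wpM2r // lerDl.
by rewrite mulrC -ler_pdivlMr // ltr_wpDl.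
Qed.

(** Differentiation under the integral sign; the chain rule brings out one more
    factor t. *)
Lemma is_derive_radial m x F i y : Ck 2 setT F -> bounded_support F ->
  is_derive y (e i) (radial m x F) (radial m.+1 x (fun z => 'D_(e i) F z) y).
Proof.
move=> CF bF; apply: is_derive_of_line.
have CF1 := CkS CF.
have [_ /(_ i)[dFi CFi]] := CF.
have [B B0 FB] :=
  bounded_support_bounded (CkS (CFi : Ck 1 setT _)) (bounded_support_derive i bF).
pose f (s t : R) := t ^+ m * F (t *: (s *: e i + y - x) + x).
have E s t : t *: (s *: e i + y - x) + x = (s * t) *: e i + (t *: (y - x) + x).
  by rewrite -addrA scalerDr scalerA [t * s]mulrC -addrA.
have Df s t : is_derive s (1 : R) (f ^~ t)
    (t ^+ m.+1 * 'D_(e i) F (t *: (s *: e i + y - x) + x)).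
  have D1 : is_derive (s * t) (1 : R) (fun u => F (u *: e i + (t *: (y - x) + x)))
     ('D_(e i) F ((s * t) *: e i + (t *: (y - x) + x))).
    exact/is_derive_line/dFi.
  have D2 : is_derive s (1 : R) (fun s => s * t) t.
    apply: is_derive_eq; by rewrite scaler0 add0r [_%:A]mulr1.
  have D3 := @is_derive1_comp _ (fun u => F (u *: e i + (t *: (y - x) + x)))
    (fun s => s * t) _ _ _ D1 D2.
  have [dF vF] := is_deriveM (is_derive_cst (t ^+ m) s (1 : R)) D3.
  rewrite (_ : f ^~ t = fun s => t ^+ m * ((fun u => F (u *: e i + (t *: (y - x) + x)))
      \o (fun s => s * t)) s); last by apply/funext => u; rewrite /f E.
  apply: DeriveDef; first exact: dF.
  by rewrite [LHS]vF scaler0 addr0 E exprSr /GRing.scale /= mulrA mulrAC.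
have mI := @measurable_itv R `[0%R, 1%R].
have I0 : `]-1, 1[%classic (0 : R) by rewrite /= in_itv /= ltr01 ltrN10.
have If s : `]-1, 1[%classic s ->
    (@lebesgue_measure R).-integrable `[0%R, 1%R] (EFin \o f s).
  by move=> _; apply: integrable01; exact: continuous_radial_integrand.
have dF s t : `]-1, 1[%classic s -> `[0%R, 1%R]%classic t -> derivable (f ^~ t) s 1.
  by move=> _ _; have [] := Df s t.
have IB : (@lebesgue_measure R).-integrable `[0%R, 1%R] (EFin \o (fun=> B)).
  by apply: integrable01 => t; exact: cst_continuous.
have fB s t : `]-1, 1[%classic s -> `[0%R, 1%R]%classic t ->
    `|partial1of2 f s t| <= B.
  move=> _; rewrite /= in_itv /= => /andP[t0 t1].
  rewrite partial1of2E; have [_ ->] := Df s t.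
  rewrite normrM ger0_norm ?exprn_ge0 // -[leRHS]mul1r ler_pM ?exprn_ge0 //.
  by rewrite exprn_ile1.
have H := @derivable_under_integral R _ _ (@lebesgue_measure R) f _ mI 0 (-1) 1
  I0 If dF (fun=> B)  (fun=> B0) IB fB.
apply: DeriveDef; first exact: H.
rewrite -derive1E.
rewrite [LHS](@differentiation_under_integral R _ _ (@lebesgue_measure R) f _ mI 0 (-1) 1
  I0 If dF (fun=> B)  (fun=> B0) IB fB).
apply: eq_Rintegral => t _; rewrite partial1of2E; have [_ ->] := Df 0 t.
by rewrite scale0r add0r.
Qed.

Lemma Ck_radial k m x F : smooth_on setT F -> bounded_support F ->
  Ck k setT (radial m x F).
Proof.
elim: k m F => [|k IH] m F CF bF.
  by split=> //; apply: continuous_subspaceT; exact: continuous_radial (CF 1%N) bF.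
split; first by apply: continuous_subspaceT; exact: continuous_radial (CF 1%N) bF.
move=> i; have D y := is_derive_radial m x i y (CF 2%N) bF.
split=> [y _|]; first by have [] := D y.
apply: (@eq_Ck _ _ _ _ (radial m.+1 x (fun z => 'D_(e i) F z))) => //.
  by move=> y _; have [_ ->] := D y.
apply: IH; last exact: bounded_support_derive.
by move=> j; have [_ /(_ i)[]] := CF j.+1.
Qed.

(** F y - F x is the integral over [0, 1] of the derivative of
    t |-> F (t (y - x) + x). *)
Lemma hadamard F x : smooth_on setT F -> bounded_support F ->
  exists h : 'I_n -> 'rV[R]_n -> R,
    [/\ forall i, smooth_on setT (h i),
        forall i, h i x = 'D_(e i) F x &
        forall y, F y - F x = \sum_i (y - x) 0 i * h i y].
Proof.
move=> CF bF; exists (fun i => radial 0 x (fun z => 'D_(e i) F z)).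
have Ci i : smooth_on setT (fun z => 'D_(e i) F z).
  by move=> j; have [_ /(_ i)[]] := CF j.+1.
split=> [i k|i|y].
- by apply: Ck_radial => //; exact: bounded_support_derive.
- rewrite /radial -[RHS]int01_cst; congr int01; apply/funext => t.
  by rewrite mul1r subrr scaler0 add0r.
- have D t : is_derive t (1 : R) (fun t => F (t *: (y - x) + x))
      (\sum_i (y - x) 0 i * 'D_(e i) F (t *: (y - x) + x)).
    rewrite -(C1_derive _ oT (CF 1%N)) //; apply: is_derive_line.
    by apply: diff_derivable; exact: (C1_differentiable oT (CF 1%N)).
  have cD i : continuous (fun t : R => (y - x) 0 i * 'D_(e i) F (t *: (y - x) + x)).
    apply: continuous_mul; first by move=> t; exact: cst_continuous.
    exact: continuous_ray (Ci i 1%N).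
  transitivity (int01 (fun t => \sum_i (y - x) 0 i * 'D_(e i) F (t *: (y - x) + x))).
    rewrite (int01_derive D); first by rewrite scale1r subrK scale0r add0r.
    by apply: continuous_big => [|i _]; [exact: add_continuous|exact: cD].
  rewrite int01_sum //; apply: eq_bigr => i _.
  rewrite int01Z; last exact: continuous_ray (Ci i 1%N).
  by congr (_ * int01 _); apply/funext => t; rewrite mul1r.
Qed.

End Hadamard.

(** * Maxima and Gronwall's inequality *)

Section LocalTests.
Context {R : realType}.

(** If c > 0, then phi1 is positive on some interval ]0, d[, and by the mean value
    theorem phi increases there. *)
Lemma second_derivative_max (phi phi1 : R -> R) (r c : R) : 0 < r ->
  (forall t, `|t| < r -> is_derive t (1 : R) phi (phi1 t)) ->
  (forall t, `|t| < r -> phi t <= phi 0) ->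
  is_derive (0 : R) (1 : R) phi1 c -> phi1 0 = 0 /\ c <= 0.
Proof.
move=> r0 dphi phimax dphi1.
have in_r t : t \in `]-r, r[%R -> `|t| < r by rewrite in_itv /= ltr_norml.
have z : phi1 0 = 0.
  have D0 : is_derive (0 : R) (1 : R) phi 0.
    apply: (@derive1_at_max _ phi (- r) r 0).
    - lra.
    - by move=> t /in_r tr; have [] := dphi t tr.
    - by rewrite in_itv /= oppr_lt0 r0.
    - by move=> t /in_r /phimax.
  have [_ E0] := D0.
  have [|_ E1] := dphi 0; first by rewrite normr0.
  by rewrite -E1 E0.
split=> //; rewrite leNgt; apply/negP => c0.
have [D E] := dphi1.
have [d /= d0 dpos] : exists2 d : R, 0 < d & forall h, 0 < h < d -> 0 < phi1 h.
  have : h^-1 *: (phi1 (h *: 1 + 0) - phi1 0) @[h --> (0 : R)^'] --> c.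
    by rewrite -E; exact: D.
  move=> /cvgr_gt /(_ 0 c0) /nbhs_ballP[d d0 hd]; exists d => // h /andP[h0 hd'].
  have := hd h; rewrite -ball_normE /= sub0r normrN gtr0_norm // => /(_ hd' (lt0r_neq0 h0)).
  by rewrite z subr0 addr0 /GRing.scale /= mulr1 pmulr_rgt0 ?invr_gt0.
pose h := Num.min d r / 2.
have m0 : 0 < Num.min d r by rewrite lt_min d0 r0.
have h0 : 0 < h by rewrite divr_gt0.
have hm : h < Num.min d r by rewrite /h; lra.
have [hd hr] : h < d /\ h < r by move: hm; rewrite lt_min => /andP.
have inr t : 0 <= t <= h -> `|t| < r by move=> /andP[t0 th]; rewrite ger0_norm //; lra.
have [||t] := @MVT R phi phi1 0 h h0.
- move=> t; rewrite in_itv /= => /andP[t0 th]; apply: dphi; apply: inr.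
  by rewrite !ltW.
- apply: derivable_within_continuous => t; rewrite in_itv /= => /inr /dphi.
  by case.
rewrite in_itv /= => /andP[t0 th] E1.
have p1 : 0 < phi1 t by apply: dpos; rewrite t0; lra.
have : phi h <= phi 0 by apply: phimax; apply: inr; rewrite lexx ltW.
by rewrite -subr_le0 E1 subr0 leNgt mulr_gt0.
Qed.

(** The function phi(t) exp(- K t) is nonincreasing on [0, 1]. *)
Lemma gronwall01 (phi phi1 : R -> R) (K : R) :
  (forall t : R, 0 <= t <= 1 -> is_derive t (1 : R) phi (phi1 t)) ->
  (forall t : R, 0 <= t <= 1 -> phi1 t <= K * phi t) ->
  phi 0 = 0 -> phi 1 <= 0.
Proof.
move=> dphi le phi0.
pose psi t := phi t * expR (- K * t).
have D (t : R) : 0 <= t <= 1 ->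
    is_derive t (1 : R) psi ((phi1 t - K * phi t) * expR (- K * t)).
  move=> t01.
  have D2 : is_derive t (1 : R) (fun s => expR (- K * s)) (expR (- K * t) * - K).
    apply: (@is_derive1_comp _ expR (fun s => - K * s)).
    apply: is_derive_eq; by rewrite /GRing.scale /= !mulr1 ?mulr0 ?addr0.
  have [dF vF] := is_deriveM (dphi t t01) D2.
  apply: DeriveDef; [exact: dF|rewrite [LHS]vF /GRing.scale /=; ring].
have [||t] := @MVT R psi (fun t => (phi1 t - K * phi t) * expR (- K * t)) 0 1 ltr01.
- by move=> t; rewrite in_itv /= => /andP[t0 t1]; apply: D; rewrite !ltW.
- by apply: derivable_within_continuous => t; rewrite in_itv /= => /D; case.
rewrite in_itv /= => /andP[t0 t1] E.
suff : psi 1 <= 0 by rewrite /psi pmulr_lle0 ?expR_gt0.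
have -> : psi 1 = psi 1 - psi 0 by rewrite /psi phi0 mul0r subr0.
rewrite E subr0 mulr1 pmulr_lle0 ?expR_gt0 // subr_le0 le // !ltW //.
Qed.

Context {n : nat}.
Implicit Types (f : 'rV[R]_n -> R) (x y v : 'rV[R]_n) (U : set 'rV[R]_n).
Local Notation e := (delta_mx 0).

Lemma open_line U x v : open U -> U x ->
  exists2 r : R, 0 < r & forall t : R, `|t| < r -> U (t *: v + x).
Proof.
move=> oU Ux; have /nbhs_ballP[s /= s0 sU] : nbhs x U by exact: open_nbhs_nbhs.
exists (s / (`|v| + 1)); first by rewrite divr_gt0 // ltr_wpDl.
move=> t; rewrite ltr_pdivlMr ?ltr_wpDl // => ts; apply: sU.
rewrite -ball_normE /= opprD addrCA subrr addr0 normrN normrZ.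
by apply: le_lt_trans ts; rewrite ler_wpM2l // lerDl.
Qed.

(** The one-dimensional test applies on every line through x. *)
Lemma Ck2_max U f x : open U -> Ck 2 U f -> U x ->
  (forall y, U y -> f y <= f x) ->
  (forall i, 'D_(e i) f x = 0) /\
  forall v, \sum_i \sum_j v 0 i * v 0 j * 'D_(e i) (fun y => 'D_(e j) f y) x <= 0.
Proof.
move=> oU Cf Ux fmax.
have Cj j : Ck 1 U (fun y => 'D_(e j) f y) by have [_ /(_ j)[]] := Cf.
have key v : 'D_v f x = 0 /\ \sum_j v 0 j * 'D_v (fun y => 'D_(e j) f y) x <= 0.
  have [r r0 rU] := open_line v oU Ux.
  pose phi1 (t : R) := \sum_j v 0 j * 'D_(e j) f (t *: v + x).
  have x0 : 0 *: v + x = x by rewrite scale0r add0r.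
  have D2 : is_derive (0 : R) (1 : R) phi1
     (\sum_j v 0 j * 'D_v (fun y => 'D_(e j) f y) x).
    rewrite (_ : phi1 = \sum_j (fun t : R => v 0 j * 'D_(e j) f (t *: v + x))); last first.
      by apply/funext => t; rewrite fct_sumE.
    apply: is_derive_sum => j.
    have D1 : is_derive (0 : R) (1 : R) (fun t : R => 'D_(e j) f (t *: v + x))
        ('D_v (fun y => 'D_(e j) f y) x).
      rewrite -{2}x0; apply: is_derive_line; rewrite x0.
      by apply: diff_derivable; exact: C1_differentiable (Cj j) Ux.
    have [dF vF] := is_deriveM (is_derive_cst (v 0 j) (0 : R) (1 : R)) D1.
    by apply: DeriveDef; [exact: dF|rewrite [LHS]vF scaler0 addr0].
  have D1 t : `|t| < r -> is_derive t (1 : R) (fun t : R => f (t *: v + x)) (phi1 t).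
    move=> tr; rewrite /phi1 -(C1_derive _ oU (CkS Cf) (rU t tr)).
    apply: is_derive_line; apply: diff_derivable.
    exact: C1_differentiable (CkS Cf) (rU t tr).
  have [|z c] := second_derivative_max r0 D1 _ D2.
    by move=> t /rU tU; rewrite x0; exact: fmax.
  split=> //; rewrite (C1_derive _ oU (CkS Cf) Ux) -[RHS]z.
  by apply: eq_bigr => j _; rewrite x0.
split=> [i|v]; first by have [] := key (e i).
have [_] := key v; rewrite exchange_big /=; apply: le_trans.
rewrite le_eqVlt; apply/orP; left; apply/eqP; apply: eq_bigr => j _.
rewrite (C1_derive _ oU (Cj j) Ux) mulr_sumr; apply: eq_bigr => i _.
by rewrite mulrA [v 0 j * _]mulrC.
Qed.

(** Gronwall's inequality along the rays from x. *)
Lemma gronwall_ball f x (r K : R) : Ck 1 (ball x r) f ->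
  (forall y, ball x r y -> 0 <= f y) ->
  (forall y i, ball x r y -> `|'D_(e i) f y| <= K * f y) ->
  f x = 0 -> forall y, ball x r y -> f y = 0.
Proof.
move=> Cf f0 Df fx y xy.
have oB : open (ball x r) by exact: ball_open.
have seg (t : R) : 0 <= t <= 1 -> ball x r (t *: (y - x) + x).
  move=> /andP[t0 t1]; move: xy; rewrite -!ball_normE /= => xy.
  rewrite opprD addrCA subrr addr0 normrN normrZ ger0_norm //.
  by rewrite (le_lt_trans _ xy) // distrC ler_piMl.
apply/eqP; rewrite eq_le f0 // andbT.
pose phi1 (t : R) := \sum_i (y - x) 0 i * 'D_(e i) f (t *: (y - x) + x).
have D1 (t : R) : 0 <= t <= 1 ->
    is_derive t (1 : R) (fun t : R => f (t *: (y - x) + x)) (phi1 t).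
  move=> /seg tB; rewrite /phi1 -(C1_derive _ oB Cf tB).
  by apply: is_derive_line; apply: diff_derivable; exact: C1_differentiable Cf tB.
have := @gronwall01 _ phi1 (\sum_(i < n) `|(y - x) 0 i| * K) D1.
rewrite scale1r subrK scale0r add0r; apply=> // t /seg tB.
rewrite /phi1 mulr_suml; apply: ler_sum => i _.
rewrite (le_trans (ler_norm _)) // normrM -mulrA ler_wpM2l //.
exact: Df.
Qed.

End LocalTests.

(** * The ring of smooth functions and the module of vector fields *)

Section Pointwise.
Context {R : realType} {n : nat} {M : smoothManifold R n}.
Local Notation C := (smooth_fun M).
Local Notation VF := (vector_field M).
Implicit Types (f g : C) (X Y : VF) (p q : M).

Lemma sfunP f g : (forall p, f p = g p) -> f = g.
Proof. by move=> fg; apply: val_inj; apply/funext. Qed.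

Lemma evD f g p : (f + g) p = f p + g p. Proof. by []. Qed.
Lemma evN f p : (- f) p = - f p. Proof. by []. Qed.
Lemma evB f g p : (f - g) p = f p - g p. Proof. by []. Qed.
Lemma evM f g p : (f * g) p = f p * g p. Proof. by []. Qed.
Lemma ev0 p : (0 : C) p = 0. Proof. by []. Qed.
Lemma ev1 p : (1 : C) p = 1. Proof. by []. Qed.

Lemma ev_sum (I : Type) (r : seq I) (P : pred I) (F : I -> C) p :
  (\sum_(i <- r | P i) F i) p = \sum_(i <- r | P i) F i p.
Proof. by elim/big_rec2 : _ => // i a b _ <-. Qed.

Lemma vfunP X Y : (forall f, X f = Y f) -> X = Y.
Proof. by move=> XY; apply: val_inj; apply/funext. Qed.

Lemma vfunD X Y f : (X + Y) f = (X f + Y f : C). Proof. by []. Qed.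
Lemma vfunN X f : (- X) f = (- X f : C). Proof. by []. Qed.
Lemma vfunZ (a : C) X f : (a *: X) f = (a * X f : C). Proof. by []. Qed.
Lemma vfun0 f : (0 : VF) f = (0 : C). Proof. by []. Qed.

Lemma vfun_sum (I : Type) (r : seq I) (P : pred I) (F : I -> VF) f :
  (\sum_(i <- r | P i) F i) f = \sum_(i <- r | P i) (F i f : C).
Proof. by elim/big_rec2 : _ => // i a b _ <-. Qed.

Lemma vf_add X f g : X (f + g) = (X f + X g : C).
Proof. by case: X => X /= /asboolP[]. Qed.

Lemma vf_cst X (a : R) f : X (sfun_cst M a * f) = (sfun_cst M a * X f : C).
Proof. by case: X => X /= /asboolP[]. Qed.

Lemma vf_leibniz X f g : X (f * g) = (X f * g + f * X g : C).
Proof. by case: X => X /= /asboolP[]. Qed.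

Lemma vf0 X : X 0 = (0 : C).
Proof. by apply: (addrI (X 0 : C)); rewrite -vf_add !addr0. Qed.

Lemma vfN X f : X (- f) = (- X f : C).
Proof. by apply: (addrI (X f : C)); rewrite -vf_add !subrr vf0. Qed.

Lemma vf_sub X f g : X (f - g) = (X f - X g : C).
Proof. by rewrite vf_add vfN. Qed.

Lemma vf1 X : X 1 = (0 : C).
Proof.
by apply: (addrI (X 1 : C)); rewrite addr0 -{3}(mulr1 1) vf_leibniz mulr1 mul1r.
Qed.

Lemma vf_const X (a : R) : X (sfun_cst M a) = (0 : C).
Proof. by rewrite -[sfun_cst M a]mulr1 vf_cst vf1 mulr0. Qed.

Lemma vf_sum X (I : Type) (r : seq I) (P : pred I) (F : I -> C) :
  X (\sum_(i <- r | P i) F i) = (\sum_(i <- r | P i) (X (F i) : C)).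
Proof.
by elim/big_rec2 : _ => [|i a b _ <-]; [exact: vf0|rewrite vf_add].
Qed.

End Pointwise.

(** * Local frames *)

Section Charts.
Context {R : realType} {n : nat} (M : smoothManifold R n).
Local Notation C := (smooth_fun M).
Local Notation VF := (vector_field M).
Local Notation e := (delta_mx 0).

Lemma open_param_preimage (c : chart R n M) (O : set M) : open O ->
  open (ccod c `&` param c @^-1` O).
Proof.
move=> oO; rewrite openE => x [cx Ox]; apply: filterI.
  exact: (open_nbhs_nbhs (conj (open_ccod c) cx)).
have := @param_continuous _ _ _ c; rewrite (continuous_open_subspace _ (open_ccod c)).
move=> /(_ x); rewrite inE => /(_ cx); apply.
exact: (open_nbhs_nbhs (conj oO Ox)).
Qed.

Lemma sfun_continuous (f : C) : continuous f.
Proof.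
move=> p; have [c Ac cp] := atlas_cover p.
have fp : {for coord c p, continuous (f \o param c)}.
  case: f => f /= /asboolP /(_ c Ac 0%N) cf.
  exact: Ck_at (open_ccod c) cf (coord_ccod cp).
have := @Defs.coord_continuous _ _ _ c; rewrite (continuous_open_subspace _ (open_cdom c)).
move=> /(_ p); rewrite inE => /(_ cp) cc.
have H : {for p, continuous ((f \o param c) \o coord c)} := continuous_comp cc fp.
have E : {near p, (f \o param c) \o coord c =1 f}.
  have : nbhs p (cdom c) by exact: (open_nbhs_nbhs (conj (open_cdom c) cp)).
  by apply: filterS => q cq /=; rewrite coordK.
rewrite /continuous_at.
have <- : ((f \o param c) \o coord c) p = f p by rewrite /= coordK.
exact: cvg_trans (near_eq_cvg E) H.
Qed.

Definition extend0 (c : chart R n M) (u : 'rV[R]_n -> R) (p : M) : R :=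
  if `[< cdom c p >] then u (coord c p) else 0.

Lemma extend0_param c u x : ccod c x -> extend0 c u (param c x) = u x.
Proof.
move=> cx; rewrite /extend0; case: asboolP => [_|]; first by rewrite paramK.
by case; exact: param_cdom.
Qed.

Lemma extend0_out c u p : ~ cdom c p -> extend0 c u p = 0.
Proof. by rewrite /extend0; case: asboolP. Qed.

(** The image of K is compact, hence closed since M is Hausdorff; off this image
    the extension is locally zero, and on the domain of c it is a composition of
    smooth maps. *)
Lemma smooth_extend0 c u (K : set 'rV[R]_n) : atlas c ->
  smooth_on (ccod c) u -> compact K -> K `<=` ccod c ->
  (forall x, ccod c x -> ~ K x -> u x = 0) -> extend0 c u \in @smooth R n M.
Proof.
move=> Ac su cK Kc u0; apply/asboolP => c' Ac' k.
have oc' := open_ccod c'; apply: Ck_local => // x cx.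
have [[z Kz zx]|nK] := pselect ((param c @` K) (param c' x)).
  exists (ccod c' `&` param c' @^-1` cdom c).
  have oV := @open_param_preimage c' _ (open_cdom c).
  split=> //; first by split=> //=; rewrite -zx; apply: param_cdom; exact: Kc.
  apply: (@eq_Ck _ _ _ _ (u \o (coord c \o param c'))) => //.
    by move=> y [_ /= cy]; rewrite /extend0; case: asboolP.
  apply: (@Ck_comp _ _ _ _ _ (ccod c)) => //; first exact: open_ccod.
    by move=> y [_ /= cy]; exact: coord_ccod.
  by move=> j; exact: atlas_compatible Ac' Ac j k.
have oK : open (~` (param c @` K)).
  apply: closed_openC; apply: compact_closed; first exact: hausdorff_carrier.
  apply: continuous_compact => //.
  exact: continuous_subspaceW Kc (@param_continuous _ _ _ c).
exists (ccod c' `&` param c' @^-1` (~` (param c @` K))).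
have oV := @open_param_preimage c' _ oK.
split=> //; apply: eq_Ck (Ck_cst k 0 oV) => // y [_ /= ny].
rewrite /extend0; case: asboolP => // cy; rewrite u0 //; first exact: coord_ccod.
by move=> Ky; apply: ny; exists (coord c (param c' y)) => //; exact: coordK.
Qed.

(** The data that turn functions and vector fields of a chart into global ones:
    they are multiplied by the bump function of the ball and extended by zero. *)
Record chart_ball := ChartBall {
  bchart : chart R n M;
  bcenter : 'rV[R]_n;
  bradius : R;
  bchart_atlas : atlas bchart;
  bradius_gt0 : 0 < bradius;
  cball_ccod : rV_cball bcenter bradius `<=` ccod bchart
}.

Lemma chart_ball_at p : exists B : chart_ball,
  cdom (bchart B) p /\ bcenter B = coord (bchart B) p.
Proof.
have [c Ac cp] := atlas_cover p.
have /nbhs_ballP[r /= r0 rc] : nbhs (coord c p) (ccod c).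
  by apply: (open_nbhs_nbhs (conj (open_ccod c) _)); exact: coord_ccod.
have r20 : 0 < r / 2 by rewrite divr_gt0.
have sub : rV_cball (coord c p) (r / 2) `<=` ccod c.
  move=> y /= yr; apply: rc; rewrite -ball_normE /= distrC.
  by apply: le_lt_trans yr _; lra.
by exists (ChartBall Ac r20 sub).
Qed.

Section Frame.
Variable B : chart_ball.
Local Notation c := (bchart B).
Local Notation x0 := (bcenter B).
Local Notation r := (bradius B).
Local Notation chi := (bump_fun x0 r).

Let oc : open (ccod c). Proof. exact: open_ccod. Qed.

Lemma Ck_bump k : Ck k (ccod c) chi.
Proof. by apply: Ck_sub (smooth_bump x0 r k) => //; exact: openT. Qed.

Lemma bump_out x : ~ rV_cball x0 r x -> chi x = 0.
Proof. by move=> /negP; rewrite -ltNge => /ltW; apply: bump_eq0; exact: bradius_gt0. Qed.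

Lemma smooth_cutoff u : smooth_on (ccod c) u ->
  extend0 c (fun x => chi x * u x) \in @smooth R n M.
Proof.
move=> su; apply: (@smooth_extend0 _ _ (rV_cball x0 r)).
- exact: bchart_atlas.
- by move=> k; apply: Ck_mul => //; exact: Ck_bump.
- exact: compact_rV_cball.
- exact: cball_ccod.
- by move=> x _ /bump_out ->; rewrite mul0r.
Qed.

Definition cutoff u (su : smooth_on (ccod c) u) : C := SmoothFun (smooth_cutoff su).

Lemma cutoff_param u (su : smooth_on (ccod c) u) x :
  ccod c x -> cutoff su (param c x) = chi x * u x.
Proof. exact: extend0_param. Qed.

Lemma cutoff_out u (su : smooth_on (ccod c) u) p : ~ cdom c p -> cutoff su p = 0.
Proof. exact: extend0_out. Qed.

Lemma smooth_param (f : C) : smooth_on (ccod c) (f \o param c).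
Proof. by case: f => f /= /asboolP; apply; exact: bchart_atlas. Qed.

Lemma smooth_partial (f : C) j :
  smooth_on (ccod c) (fun x => 'D_(e j) (f \o param c) x).
Proof. by move=> k; have [_ /(_ j)[]] := smooth_param f k.+1. Qed.

Lemma is_derive_coordinate i j x :
  is_derive x (e i) (fun x : 'rV[R]_n => x 0 j) (i == j)%:R.
Proof.
apply: is_derive_of_line.
rewrite (_ : (fun t : R => _) = (fun t : R => t * (i == j)%:R + x 0 j)); last first.
  by apply/funext => t; rewrite !mxE eqxx /= eq_sym.
by apply: is_derive_eq; rewrite /GRing.scale /= mulr0 add0r addr0 mulr1.
Qed.

Lemma smooth_coordinate j : smooth_on (ccod c) (fun x => x 0 j).
Proof.
move=> k; elim: k => [|k IH]; first split=> //.
  by apply: continuous_subspaceT; exact: rV_coord_continuous.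
have D i := is_derive_coordinate i j.
split; first exact: Ck_continuous IH.
move=> i; split=> [x _|]; first by have [] := D i x.
by apply: eq_Ck (Ck_cst k (i == j)%:R oc) => // x _; have [_ ->] := D i x.
Qed.

Let one_smooth : smooth_on (ccod c) (fun=> 1).
Proof. by move=> k; exact: Ck_cst. Qed.

Definition cutoff1 : C := cutoff one_smooth.
Definition cutoff_coord k : C := cutoff (smooth_coordinate k).

Lemma derivable_param (f : C) j x : ccod c x -> derivable (f \o param c) x (e j).
Proof. by move=> cx; have [_ /(_ j)[+ _]] := smooth_param f 1%N; apply. Qed.

Definition partial_field (j : 'I_n) (f : C) : C^o := cutoff (smooth_partial f j).

Lemma partial_derivation j : partial_field j \in @derivations R n M.
Proof.
apply/asboolP; split=> [f g|a f|f g]; apply: sfunP => p;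
  (have [cp|cp] := pselect (cdom c p);
   [rewrite -(coordK cp); set x := coord c p; have cx : ccod c x by exact: coord_ccod|]).
- rewrite evD !cutoff_param // -mulrDr; congr (_ * _).
  by rewrite -[RHS]deriveD //; exact: derivable_param.
- by rewrite evD !cutoff_out // addr0.
- rewrite evM !cutoff_param // mulrCA; congr (_ * _).
  rewrite -[RHS]deriveZ //; last exact: derivable_param.
- by rewrite evM !cutoff_out // mulr0.
- rewrite evD !evM !cutoff_param //.
  rewrite (_ : (f * g : C) \o param c = (f \o param c) * (g \o param c)) //.
  rewrite deriveM; [|exact: derivable_param..].
  rewrite /GRing.scale /=; ring.
- by rewrite evD !evM !cutoff_out // mulr0 mul0r addr0.
Qed.

Definition frame j : VF := VectorField (partial_derivation j).

Lemma frame_param j (f : C) x : ccod c x ->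
  frame j f (param c x) = chi x * 'D_(e j) (f \o param c) x.
Proof. exact: cutoff_param. Qed.

(** On the chart domain this is chi^2 X(x_k), where chi is the bump function: the
    second term removes the derivative of chi from X(chi x_k).  Together with the
    factor chi of the frame this makes weight = chi^3.  Both are locked so that
    the rules for evaluating sums and products do not unfold them. *)
Definition coframe k (X : VF) : C := locked
  (cutoff1 * (X (cutoff_coord k) : C) - cutoff_coord k * (X cutoff1 : C)).

Definition weight : C := locked (cutoff1 ^+ 3).

Lemma coframeE k X : coframe k X =
  cutoff1 * (X (cutoff_coord k) : C) - cutoff_coord k * (X cutoff1 : C).
Proof. by rewrite /coframe -lock. Qed.

Lemma weightE : weight = cutoff1 ^+ 3.
Proof. by rewrite /weight -lock. Qed.

Lemma cutoff1_param x : ccod c x -> cutoff1 (param c x) = chi x.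
Proof. by move=> cx; rewrite cutoff_param // mulr1. Qed.

Lemma weight_param x : ccod c x -> weight (param c x) = chi x ^+ 3.
Proof.
move=> cx; rewrite weightE !exprS expr0 mulr1 !evM cutoff1_param //; ring.
Qed.

Lemma weight_out p : ~ cdom c p -> weight p = 0.
Proof. by move=> cp; rewrite weightE exprS evM cutoff_out // mul0r. Qed.

Lemma coframeD k X Y : coframe k (X + Y) = coframe k X + coframe k Y.
Proof. by rewrite !coframeE !vfunD !mulrDr opprD addrACA. Qed.

Lemma coframeZ k (a : C) X : coframe k (a *: X) = a * coframe k X.
Proof. by rewrite !coframeE !vfunZ mulrBr !(mulrCA a). Qed.

Lemma coframe_frame k j : coframe k (frame j) = (k == j)%:R * weight.
Proof.
apply: sfunP => p; have [cp|cp] := pselect (cdom c p); last first.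
  by rewrite evM weight_out // coframeE evB !evM !cutoff_out // !mul0r subr0 mulr0.
rewrite -(coordK cp); set x := coord c p; have cx : ccod c x by exact: coord_ccod.
have chi1 : {near x, cutoff1 \o param c =1 chi}.
  have : nbhs x (ccod c) by exact: (open_nbhs_nbhs (conj oc cx)).
  by apply: filterS => y cy; exact: cutoff1_param.
have chik : {near x, cutoff_coord k \o param c =1 chi * (fun y : 'rV[R]_n => y 0 k)}.
  have : nbhs x (ccod c) by exact: (open_nbhs_nbhs (conj oc cx)).
  by apply: filterS => y cy; exact: cutoff_param.
have dchi : derivable chi x (e j) by have [_ /(_ j)[/(_ x cx)]] := Ck_bump 1.
have [dk Dk] := is_derive_coordinate j k x.
rewrite evM weight_param // coframeE evB !evM cutoff1_param // !frame_param //.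
rewrite (near_eq_derive _ chi1) (near_eq_derive _ chik) deriveM // cutoff_param // Dk.
have -> : ((k == j)%:R : C) (param c x) = (k == j)%:R by case: (k == j).
rewrite eq_sym /GRing.scale /=; ring.
Qed.

End Frame.
End Charts.

Section FrameExpansion.
Context {R : realType} {n : nat} {M : smoothManifold R n} (B : chart_ball M).
Local Notation C := (smooth_fun M).
Local Notation VF := (vector_field M).
Local Notation e := (delta_mx 0).
Local Notation c := (bchart B).
Local Notation x0 := (bcenter B).
Local Notation r := (bradius B).
Local Notation chi := (bump_fun x0 r).

Let rV_cutoff (u : 'rV[R]_n -> R) (x : 'rV[R]_n) : R :=
  if `[< ccod c x >] then chi x * u x else 0.

Let rV_cutoff_in u x : ccod c x -> rV_cutoff u x = chi x * u x.
Proof. by rewrite /rV_cutoff; case: asboolP. Qed.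

Let smooth_rV_cutoff u : smooth_on (ccod c) u -> smooth_on setT (rV_cutoff u).
Proof.
move=> su k; apply: Ck_local; first exact: openT.
move=> x _; have [cx|ncx] := pselect (ccod c x).
  exists (ccod c); split=> //; first exact: open_ccod.
  apply: (@eq_Ck _ _ _ _ (chi * u)); first exact: open_ccod; last first.
    by apply: Ck_mul; [exact: open_ccod|exact: Ck_bump|exact: su].
  by move=> y cy; rewrite rV_cutoff_in.
have oV : open (~` rV_cball x0 r) by apply: closed_openC; exact: closed_rV_cball.
exists (~` rV_cball x0 r); split=> //; first by move/cball_ccod.
apply: eq_Ck (Ck_cst k 0 oV) => // y ny.
by rewrite /rV_cutoff; case: asboolP => // _; rewrite bump_out // mul0r.
Qed.

Let bounded_rV_cutoff u : bounded_support (rV_cutoff u).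
Proof.
exists (r + `|x0|) => y yr; rewrite /rV_cutoff; case: asboolP => // _.
rewrite bump_out ?mul0r // => /= yx.
have := ler_normD (y - x0) x0; rewrite subrK leNgt => /negP; apply.
by apply: le_lt_trans yr; rewrite lerD2r.
Qed.

(** X is applied to Hadamard's formula for chi f, multiplied by chi^2 so that
    every factor of it is a global smooth function.  The terms in which f is not
    differentiated are those of the case f = 1. *)
Let frame_expand0 (X : VF) (f : C) x : ccod c x ->
  chi x ^+ 2 * (X (cutoff1 B) : C) (param c x) * f (param c x) +
    chi x ^+ 3 * (X f : C) (param c x) =
  \sum_k coframe B k X (param c x) *
    ('D_(e k) chi x * f (param c x) + chi x * 'D_(e k) (f \o param c) x).
Proof.
move=> cx; set p := param c x; set F := rV_cutoff (f \o param c).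
have [h [sh hx hE]] :=
  hadamard x (smooth_rV_cutoff (smooth_param B f)) (bounded_rV_cutoff _).
have shc i : smooth_on (ccod c) (h i).
  by move=> k; apply: Ck_sub (sh i k) => //; [exact: openT|exact: open_ccod].
pose H i : C := cutoff (shc i).
pose A := cutoff1 B.
pose xk k : C := sfun_cst M (x 0 k).
have E : A * A * (A * f) - sfun_cst M (F x) * (A * A) =
    \sum_k (cutoff_coord B k - xk k * A) * H k.
  apply: sfunP => q; rewrite ev_sum evB !evM.
  have [cq|ncq] := pselect (cdom c q); last first.
    rewrite /A !cutoff_out // !mul0r mulr0 subr0 big1 // => k _.
    by rewrite evM (@cutoff_out _ _ _ B (h k)) // mulr0.
  rewrite -(coordK cq); set y := coord c q; have cy : ccod c y by exact: coord_ccod.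
  rewrite /A !cutoff1_param //.
  transitivity (chi y * chi y * (F y - F x)).
    rewrite /F (@rV_cutoff_in _ y) //=; ring.
  rewrite hE mulr_sumr; apply: eq_bigr => k _.
  rewrite evM evB !evM !cutoff_param // !mxE.
  have -> : xk k (param c y) = x 0 k by [].
  ring.
have {E} := congr1 (fun u : C => (X u : C) p) E.
have cp : A p = chi x by exact: cutoff1_param.
rewrite vf_sub vf_cst vf_sum ev_sum !vf_leibniz !(evB, evD, evM) cp.
have -> : (sfun_cst M (F x)) p = F x by [].
rewrite /F (@rV_cutoff_in _ x) // -/p => E.
transitivity (\sum_k (X (cutoff_coord B k) p - x 0 k * X A p) * (chi x * h k x)).
  apply: etrans; last apply: etrans E _.
    rewrite /= -/p; ring.
  apply: eq_bigr => k _.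
  rewrite vf_leibniz evD !evM evB !evM vf_sub vf_cst evB evM cp.
  rewrite /H !cutoff_param //.
  have -> : (xk k) p = x 0 k by [].
  ring.
apply: eq_bigr => k _; rewrite hx /F.
have nF : {near x, rV_cutoff (f \o param c) =1 chi * (f \o param c)}.
  have : nbhs x (ccod c) by exact: (open_nbhs_nbhs (conj (open_ccod c) cx)).
  by apply: filterS => y cy; exact: rV_cutoff_in.
have dchi : derivable chi x (e k).
  by have [_ /(_ k)[/(_ x cx)]] := @Ck_bump _ _ _ B 1.
rewrite (near_eq_derive _ nF) deriveM //; last exact: derivable_param.
rewrite coframeE evB !evM -/A cp cutoff_param // /GRing.scale /=; ring.
Qed.

(** By Hadamard's lemma a derivation only sees the first-order part of f, so that
    X f = sum_k X(x_k) d_k f in the chart. *)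
Lemma frame_expand (X : VF) : weight B *: X = \sum_k coframe B k X *: frame B k.
Proof.
apply: vfunP => f; apply: sfunP => p.
rewrite vfunZ evM vfun_sum ev_sum.
have [cp|cp] := pselect (cdom c p); last first.
  rewrite weight_out // mul0r big1 // => k _.
  by rewrite vfunZ evM (@cutoff_out _ _ _ B) // mulr0.
rewrite -(coordK cp); set x := coord c p; have cx : ccod c x by exact: coord_ccod.
have Ef := frame_expand0 X f cx; have E1 := frame_expand0 X 1 cx.
rewrite vf1 ev0 ev1 mulr0 addr0 mulr1 in E1.
rewrite weight_param //.
have {}E1 : chi x ^+ 2 * X (cutoff1 B) (param c x) =
    \sum_k coframe B k X (param c x) * 'D_(e k) chi x.
  rewrite E1; apply: eq_bigr => k _; congr (_ * _).
  rewrite mulr1 (_ : (1 : C) \o param c = cst 1) // derive_cst mulr0 addr0 //.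
rewrite E1 mulr_suml in Ef.
apply: (addrI (\sum_k coframe B k X (param c x) * 'D_(e k) chi x * f (param c x))).
rewrite Ef -big_split; apply: eq_bigr => k _.
rewrite -[RHS]/(coframe B k X (param c x) * 'D_(e k) chi x * f (param c x) +
  (coframe B k X *: frame B k) f (param c x)).
rewrite vfunZ evM frame_param //; ring.
Qed.

End FrameExpansion.

Section Maximum.
Context {R : realType} {n : nat} {M : smoothManifold R n}.
Local Notation C := (smooth_fun M).
Local Notation VF := (vector_field M).
Local Notation e := (delta_mx 0).

Lemma weight_neq0 p : exists2 B : chart_ball M, cdom (bchart B) p & weight B p != 0.
Proof.
have [B [Bp Bc]] := chart_ball_at p; exists B => //.
rewrite -(coordK Bp) weight_param; last exact: coord_ccod.
rewrite expf_neq0 // gt_eqF // bump_gt0 // Bc subrr normr0; exact: bradius_gt0.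
Qed.

(** By frame_expand, X f and X (X f) at p are combinations of the first and second
    partial derivatives of f in a chart. *)
Lemma maximum_conditions (f : C) p : (forall q, f q <= f p) ->
  forall X : VF, (X f : C) p = 0 /\ (X (X f) : C) p <= 0.
Proof.
move=> fmax X; have [B Bp wp] := weight_neq0 p.
have cp := coord_ccod Bp; set c := bchart B in Bp cp; set x := coord c p in cp.
pose chi := bump_fun (bcenter B) (bradius B).
pose F := f \o param c.
have [|D1 D2] := Ck2_max (open_ccod c) (smooth_param B f 2) cp.
  by move=> y cy; rewrite /= (coordK Bp); exact: fmax.
have px : param c x = p by exact: coordK.
have Ew g : weight B * (X g : C) = \sum_k coframe B k X * (frame B k g : C).
  have := congr1 (fun Y : VF => (Y g : C)) (frame_expand B X).
  by rewrite vfunZ vfun_sum.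
have Xf0 : (X f : C) p = 0.
  have := congr1 (fun u : C => u p) (Ew f); rewrite ev_sum evM big1 => [/eqP|k _].
    by rewrite mulf_eq0 (negbTE wp) => /eqP.
  by rewrite evM -{2}px frame_param // D1 !mulr0.
have fr0 k : (frame B k f : C) p = 0 by rewrite -px frame_param // D1 mulr0.
split=> //.
have fr2 j k : (frame B j (frame B k f) : C) p =
    chi x ^+ 2 * 'D_(e j) (fun y => 'D_(e k) F y) x.
  rewrite -px frame_param //.
  have nF : {near x, (frame B k f : C) \o param c =1 chi * (fun y => 'D_(e k) F y)}.
    have : nbhs x (ccod c) by exact: (open_nbhs_nbhs (conj (open_ccod c) cp)).
    by apply: filterS => y cy; exact: frame_param.
  have dchi : derivable chi x (e j).
    by have [_ /(_ j)[/(_ x cp)]] := @Ck_bump _ _ _ B 1.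
  have dF : derivable (fun y => 'D_(e k) F y) x (e j).
    by have [_ /(_ j)[/(_ x cp)]] := smooth_partial B f k 1.
  rewrite (near_eq_derive _ nF) deriveM // D1 scale0r addr0 /GRing.scale /= -/chi; ring.
pose v : 'rV[R]_n := \row_k coframe B k X p.
have E : weight B p ^+ 2 * (X (X f) : C) p =
    chi x ^+ 2 * \sum_j \sum_k v 0 j * v 0 k * 'D_(e j) (fun y => 'D_(e k) F y) x.
  have := congr1 (fun u : C => weight B p * (X u : C) p) (Ew f).
  rewrite vf_leibniz evD !evM Xf0 mulr0 add0r mulrA -expr2 => ->.
  rewrite vf_sum ev_sum [in RHS]exchange_big !mulr_sumr; apply: eq_bigr => k _.
  rewrite vf_leibniz evD !evM fr0 mulr0 add0r mulrCA.
  have := congr1 (fun u : C => u p) (Ew (frame B k f)).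
  rewrite evM => ->; rewrite ev_sum !mulr_sumr; apply: eq_bigr => j _.
  by rewrite evM fr2 /v !mxE; ring.
have w2 : 0 < weight B p ^+ 2 by rewrite exprn_even_gt0.
rewrite -(pmulr_rle0 _ w2) E; apply: mulr_ge0_le0; last exact: D2.
exact: sqr_ge0.
Qed.

End Maximum.

(** * Tensors *)

Section Tensorial.
Context {R : realType} {n : nat} {M : smoothManifold R n}.
Local Notation C := (smooth_fun M).
Local Notation VF := (vector_field M).
Local Notation e := (delta_mx 0).

Definition tensorial (al : VF -> C) : Prop :=
  (forall X Y, al (X + Y) = al X + al Y) /\ (forall (a : C) X, al (a *: X) = a * al X).

Lemma tensorial0 al : tensorial al -> al 0 = 0.
Proof. by case=> _ aZ; rewrite -(scale0r (0 : VF)) aZ mul0r. Qed.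

Lemma tensorial_sum al (I : Type) (s : seq I) (F : I -> VF) : tensorial al ->
  al (\sum_(i <- s) F i) = \sum_(i <- s) al (F i).
Proof.
move=> ta; have [aD _] := ta; elim: s => [|i s IH].
  by rewrite !big_nil tensorial0.
by rewrite !big_cons aD IH.
Qed.

Lemma tensorial_expand (B : chart_ball M) al X : tensorial al ->
  weight B * al X = \sum_k coframe B k X * al (frame B k).
Proof.
move=> ta; have [_ aZ] := ta; rewrite -aZ frame_expand tensorial_sum //.
by apply: eq_bigr => k _; rewrite aZ.
Qed.

Lemma tensorial_vanish (B : chart_ball M) al q : tensorial al ->
  weight B q != 0 -> (forall k, al (frame B k) q = 0) -> forall X, al X q = 0.
Proof.
move=> ta wq a0 X; apply: (mulfI wq); rewrite mulr0.
rewrite -[LHS]/((weight B * al X) q) (tensorial_expand B X ta) ev_sum big1 // => k _.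
by rewrite evM a0 mulr0.
Qed.

(** The components of a parallel tensor in a frame solve a linear differential
    system, so Gronwall's inequality makes the zero set of the tensor open. *)
Lemma parallel_vanish_near (T : VF -> VF -> C) (D : VF -> VF -> VF) p :
  (forall Z, tensorial (T ^~ Z)) -> (forall Y, tensorial (T Y)) ->
  (forall X Y Z : VF, X (T Y Z) = (T (D X Y) Z + T Y (D X Z) : C)) ->
  (forall Y Z, T Y Z p = 0) -> \forall q \near p, forall Y Z, T Y Z q = 0.
Proof.
move=> Tl Tr TD T0; have [B [Bp Bc]] := chart_ball_at p.
set c := bchart B in Bp Bc; pose x := coord c p.
have cx : ccod c x by exact: coord_ccod.
pose r := bradius B / 2.
have r0 : 0 < r by rewrite divr_gt0 // bradius_gt0.
have rr : r < bradius B by rewrite /r; have := bradius_gt0 B; lra.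
pose chi := bump_fun (bcenter B) (bradius B).
have ballc y : ball x r y -> rV_cball x r y.
  by rewrite -ball_normE /= distrC => /ltW.
have cballc y : rV_cball x r y -> ccod c y.
  move=> yr; apply: cball_ccod; rewrite Bc; apply: (le_trans yr); exact: ltW.
have xx : rV_cball x r x by rewrite /rV_cball /= subrr normr0 ltW.
have chi_gt0 y : rV_cball x r y -> 0 < chi y.
  by move=> yr; apply: bump_gt0; rewrite Bc; exact: le_lt_trans rr.
have bounded (h : C) : exists K : R, 0 <= K /\
    forall y, rV_cball x r y -> `|h (param c y)| <= K.
  have [||| y0 _ ymax] := @compact_EVT_max _ R (fun y => `|h (param c y)|) (rV_cball x r).
  - by exists x.
  - exact: compact_rV_cball.
  - apply: (@continuous_subspaceW _ _ _ (ccod c)); first exact: cballc.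
    rewrite continuous_open_subspace; last exact: open_ccod.
    move=> y /[!inE] cy.
    apply: (@continuous_comp _ _ _ (h \o param c) (fun t : R => `|t|)).
      exact: Ck_at (open_ccod c) (smooth_param B h 0) cy.
    exact: norm_continuous.
  exists `|h (param c y0)|; split=> // y yr; apply: ymax; exact: mem_set.
(* In the chart, weight times a field of the frame is chi^4 times a partial
   derivative; this is a lower bound for the factor. *)
have [m m0 chim] : exists2 m : R, 0 < m & forall y, rV_cball x r y -> m <= chi y ^+ 4.
  have [||| y0 y0r ymin] := @compact_EVT_min _ R (fun y => chi y ^+ 4) (rV_cball x r).
  - by exists x.
  - exact: compact_rV_cball.
  - apply: continuous_subspaceT => y.
    apply: (@continuous_comp _ _ _ chi (fun t : R => t ^+ 4)); last exact: exprn_continuous.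
    exact: (Ck_at openT (smooth_bump _ _ 0)).
  exists (chi y0 ^+ 4); first by rewrite exprn_gt0 //; apply: chi_gt0; exact: set_mem y0r.
  by move=> y yr; apply: ymin; exact: mem_set.
pose t i j := T (frame B i) (frame B j).
pose a k i l := coframe B l (D (frame B k) (frame B i)).
(* Gronwall's inequality is applied to the sum of the squared components. *)
pose v : C := \sum_i \sum_j t i j * t i j.
have vE q : v q = \sum_i \sum_j t i j q ^+ 2.
  by rewrite ev_sum; apply: eq_bigr => i _; rewrite ev_sum.
have v_ge i j q : t i j q ^+ 2 <= v q.
  rewrite vE (bigD1 i) //= (bigD1 j) //= -addrA lerDl addr_ge0 ?sumr_ge0 // => *;
    rewrite ?sumr_ge0 // => *; exact: sqr_ge0.
have v0 q : 0 <= v q.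
  by rewrite vE; apply: sumr_ge0 => i _; apply: sumr_ge0 => j _; exact: sqr_ge0.
have tt i j i' j' q : `|t i j q * t i' j' q| <= v q.
  have := v_ge i j q; have := v_ge i' j' q.
  have := sqr_ge0 (t i j q - t i' j' q); have := sqr_ge0 (t i j q + t i' j' q).
  by rewrite ler_norml => *; apply/andP; split; nra.
have wD k i j : weight B * (frame B k (t i j) : C) =
    \sum_l (a k i l * t l j + a k j l * t i l).
  rewrite /t TD mulrDr (tensorial_expand B _ (Tl _)) (tensorial_expand B _ (Tr _)).
  by rewrite big_split.
have /choice[Kf KfP] : forall kil : 'I_n * 'I_n * 'I_n, exists K : R, 0 <= K /\
    forall y, rV_cball x r y -> `|a kil.1.1 kil.1.2 kil.2 (param c y)| <= K.
  by move=> kil; exact: bounded.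
pose N k := \sum_i \sum_j \sum_l 2 * (Kf (k, i, l) + Kf (k, j, l)).
have N0 k : 0 <= N k.
  apply: sumr_ge0 => i _; apply: sumr_ge0 => j _; apply: sumr_ge0 => l _.
  by rewrite mulr_ge0 // addr_ge0 //; apply: (KfP _).1.
have wv k y : rV_cball x r y ->
    `|(weight B * (frame B k v : C)) (param c y)| <= N k * v (param c y).
  move=> yr; set q := param c y.
  have -> : (weight B * (frame B k v : C)) q = \sum_i \sum_j \sum_l
      2 * (a k i l q * (t i j q * t l j q) + a k j l q * (t i j q * t i l q)).
    rewrite evM vf_sum ev_sum mulr_sumr; apply: eq_bigr => i _.
    rewrite vf_sum ev_sum mulr_sumr; apply: eq_bigr => j _.
    have := congr1 (fun u : C => u q) (wD k i j); rewrite evM ev_sum => E.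
    rewrite vf_leibniz evD !evM.
    transitivity (2 * t i j q * (weight B q * (frame B k (t i j) : C) q)); first by ring.
    by rewrite E mulr_sumr; apply: eq_bigr => l _; rewrite evD !evM; ring.
  rewrite /N mulr_suml (le_trans (ler_norm_sum _ _ _)) //; apply: ler_sum => i _.
  rewrite mulr_suml (le_trans (ler_norm_sum _ _ _)) //; apply: ler_sum => j _.
  rewrite mulr_suml (le_trans (ler_norm_sum _ _ _)) //; apply: ler_sum => l _.
  rewrite normrM ger0_norm // -mulrA ler_pM2l // (le_trans (ler_normD _ _)) //.
  rewrite mulrDl; apply: lerD; rewrite normrM ler_pM //;
    by [apply: (KfP (_, _, _)).2 | exact: tt].
have Dv y k : ball x r y -> `|'D_(e k) (v \o param c) y| <=
    (\sum_k N k) / m * (v \o param c) y.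
  move=> /ballc yr; have cy := cballc y yr.
  have := wv k y yr; rewrite evM weight_param // frame_param // mulrA -exprSr.
  rewrite normrM ger0_norm; last by rewrite exprn_ge0 // ltW // chi_gt0.
  have Nk : N k <= \sum_k N k by rewrite (bigD1 k) //= lerDl sumr_ge0.
  move=> le.
  have : m * `|'D_(e k) (v \o param c) y| <= (\sum_k N k) * v (param c y).
    apply: (le_trans (ler_wpM2r (normr_ge0 _) (chim y yr))).
    by apply: (le_trans le); rewrite ler_wpM2r.
  by rewrite mulrAC ler_pdivlMr // mulrC.
have vball y : ball x r y -> v (param c y) = 0.
  move=> yr; apply: (@gronwall_ball _ _ (v \o param c) x r ((\sum_k N k) / m)) => //.
  - apply: Ck_sub (smooth_param B v 1); [exact: open_ccod|exact: ball_open|].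
    by move=> z /ballc /cballc.
  - by move=> z _; exact: v0.
  - rewrite -[LHS]/(v (param c x)) /x coordK // vE big1 // => i _; rewrite big1 // => j _.
    by rewrite /t T0 expr0n.
have tball y i j : ball x r y -> t i j (param c y) = 0.
  move=> /vball vy; apply/eqP; rewrite -sqrf_eq0 eq_le sqr_ge0 andbT -vy; exact: v_ge.
have near_ball : \forall q \near p, cdom c q /\ ball x r (coord c q).
  apply: filterI; first exact: (open_nbhs_nbhs (conj (open_cdom c) Bp)).
  have := @Defs.coord_continuous _ _ _ c; rewrite (continuous_open_subspace _ (open_cdom c)).
  move=> /(_ p); rewrite inE => /(_ Bp); apply.
  exact: nbhsx_ballx.
apply: filterS near_ball => q [cq qr] Y Z; rewrite -(coordK cq).
have wq : weight B (param c (coord c q)) != 0.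
  by rewrite weight_param ?expf_neq0 ?gt_eqF ?chi_gt0 //; [exact: ballc|exact: coord_ccod].
apply: (tensorial_vanish (Tl Z) wq) => i.
apply: (tensorial_vanish (Tr _) wq) => j.
exact: tball.
Qed.

(** The common zero set is closed, and open by parallel_vanish_near. *)
Lemma parallel_vanish (T : VF -> VF -> C) (D : VF -> VF -> VF) p :
  connected [set: M] ->
  (forall Z, tensorial (T ^~ Z)) -> (forall Y, tensorial (T Y)) ->
  (forall X Y Z : VF, X (T Y Z) = (T (D X Y) Z + T Y (D X Z) : C)) ->
  (forall Y Z, T Y Z p = 0) -> forall Y Z q, T Y Z q = 0.
Proof.
move=> cM Tl Tr TD T0.
pose A := [set q : M | forall Y Z, T Y Z q = 0].
suff AT : A = setT by move=> Y Z q; have : A q by rewrite AT.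
apply: cM; first by exists p.
- exists A; last by rewrite setTI.
  by rewrite openE => q Aq; exact: parallel_vanish_near Aq.
- exists A; last by rewrite setTI.
  rewrite (_ : A = \bigcap_(YZ in [set: VF * VF]) (T YZ.1 YZ.2 @^-1` [set (0 : R)])).
    apply: closed_bigI => YZ _; apply: closed_comp => [q _|]; first exact: sfun_continuous.
    exact: closed_eq.
  apply/seteqP; split=> [q Aq YZ _|q Aq Y Z]; first exact: Aq.
  exact: (Aq (Y, Z)).
Qed.

End Tensorial.

Section Traces.
Context {R : realType} {n : nat} {M : smoothManifold R n}.
Local Notation C := (smooth_fun M).
Local Notation VF := (vector_field M).
Variable g : riemannian_metric M.

Lemma metricDr X Y Z : g X (Y + Z) = g X Y + g X Z.
Proof. by rewrite metricC metricDl !(metricC g _ X). Qed.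

Lemma metricZr (a : C) X Y : g X (a *: Y) = a * g X Y.
Proof. by rewrite metricC metricZl (metricC g Y). Qed.

Lemma metricNl X Y : g (- X) Y = - g X Y.
Proof. by rewrite -scaleN1r metricZl mulN1r. Qed.

Lemma metricNr X Y : g X (- Y) = - g X Y.
Proof. by rewrite metricC metricNl metricC. Qed.

Lemma tensorial_metricl Z : tensorial (g ^~ Z).
Proof. by split=> [X Y|a X]; [exact: metricDl|exact: metricZl]. Qed.

Lemma tensorial_metricr Z : tensorial (g Z).
Proof. by split=> [X Y|a X]; [exact: metricDr|exact: metricZr]. Qed.

(** n orthonormal vectors span, because the module of vector fields is locally
    generated by the n fields of a frame. *)
Lemma parseval (al : VF -> C) q E X : orthonormal_at g q E -> tensorial al ->
  al X q = \sum_i g X (E i) q * al (E i) q.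
Proof.
move=> oE ta; have [B Bq wq] := weight_neq0 q; set w := weight B q in wq.
pose A : 'M[R]_n := \matrix_(i, j) coframe B j (E i) q.
pose G : 'M[R]_n := \matrix_(j, i) g (frame B j) (E i) q.
have expand (be : VF -> C) Y : tensorial be ->
    w * be Y q = \sum_k coframe B k Y q * be (frame B k) q.
  move=> tb; rewrite /w -evM (tensorial_expand B Y tb) ev_sum.
  by apply: eq_bigr => k _; rewrite evM.
have AG : (w^-1 *: A) *m G = 1%:M.
  rewrite -scalemxAl; apply/matrixP => i k; rewrite !mxE.
  apply: (mulfI wq); rewrite mulVKf // -oE (expand _ _ (tensorial_metricl (E k))).
  by apply: eq_bigr => j _; rewrite !mxE.
(* A and G are square, so the left inverse is a right inverse. *)
have GA j l : \sum_k g (frame B j) (E k) q * coframe B l (E k) q = w * (j == l)%:R.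
  have := mulmx1C AG; rewrite -scalemxAr => /matrixP/(_ j l); rewrite !mxE => <-.
  by rewrite mulVKf //; apply: eq_bigr => k _; rewrite !mxE.
have frameE j : al (frame B j) q = \sum_k g (frame B j) (E k) q * al (E k) q.
  apply: (mulfI wq); rewrite mulr_sumr.
  transitivity (\sum_l \sum_k g (frame B j) (E k) q * coframe B l (E k) q * al (frame B l) q).
    rewrite (bigD1 j) //= -mulr_suml GA eqxx mulr1 big1 ?addr0 // => l lj.
    by rewrite -mulr_suml GA eq_sym (negbTE lj) mulr0 mul0r.
  rewrite exchange_big; apply: eq_bigr => k _ /=.
  rewrite mulrCA (expand _ _ ta) mulr_sumr; apply: eq_bigr => l _.
  by rewrite mulrA.
apply: (mulfI wq); rewrite (expand _ _ ta) mulr_sumr.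
under eq_bigr do rewrite frameE mulr_sumr.
rewrite exchange_big; apply: eq_bigr => k _ /=.
rewrite mulrA (expand _ _ (tensorial_metricl (E k))) mulr_suml.
by apply: eq_bigr => l _; rewrite mulrA.
Qed.

Definition endo (Phi : VF -> VF) : Prop :=
  (forall X Y, Phi (X + Y) = Phi X + Phi Y) /\
  (forall (a : C) X, Phi (a *: X) = a *: Phi X).

Lemma tensorial_endo al Phi : tensorial al -> endo Phi -> tensorial (al \o Phi).
Proof.
move=> [aD aZ] [PD PZ]; split=> [X Y|a X] /=; first by rewrite PD aD.
by rewrite PZ aZ.
Qed.

Lemma tensorial_coframe (B : chart_ball M) k : tensorial (coframe B k).
Proof. by split=> [X Y|a X]; [exact: coframeD|exact: coframeZ]. Qed.

Lemma trace_frame (B : chart_ball M) q E Phi : orthonormal_at g q E -> endo Phi ->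
  weight B q * (\sum_i g (Phi (E i)) (E i) q) =
  \sum_j coframe B j (Phi (frame B j)) q.
Proof.
move=> oE eP; rewrite mulr_sumr.
transitivity (\sum_i \sum_j coframe B j (Phi (E i)) q * g (frame B j) (E i) q).
  apply: eq_bigr => i _.
  rewrite -evM (tensorial_expand B _ (tensorial_metricl (E i))) ev_sum.
  by apply: eq_bigr => j _; rewrite evM.
rewrite exchange_big; apply: eq_bigr => j _ /=.
rewrite -[RHS]/((coframe B j \o Phi) (frame B j) q).
rewrite (parseval _ oE (tensorial_endo (tensorial_coframe B j) eP)).
by apply: eq_bigr => i _; rewrite mulrC.
Qed.

(** Derivations commute with traces.  The frames E q need not vary smoothly
    with q, so the trace is compared with its expression in a smooth frame, where
    the derivatives of the coframe and those of the frame cancel. *)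
Lemma derive_trace (E : M -> 'I_n -> VF) (Phi D : VF -> VF) (X0 : VF) (t : C) p :
  (forall q, orthonormal_at g q (E q)) -> endo Phi ->
  (forall X Y, D (X + Y) = D X + D Y) ->
  (forall (a : C) X, D (a *: X) = (X0 a : C) *: X + a *: D X) ->
  (forall q, t q = \sum_i g (Phi (E q i)) (E q i) q) ->
  (X0 t : C) p = \sum_i g (D (Phi (E p i)) - Phi (D (E p i))) (E p i) p.
Proof.
move=> oE eP DD DZ tE; have [PD PZ] := eP.
have [B Bp wp] := weight_neq0 p; pose w := weight B; pose F := frame B.
pose c j X := coframe B j X.
pose Psi X := D (Phi X) - Phi (D X).
have PN X : Phi (- X) = - Phi X by rewrite -scaleN1r PZ scaleN1r.
have ePsi : endo Psi.
  split=> [X Y|a X]; rewrite /Psi.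
    by rewrite PD !DD PD opprD addrACA.
  by rewrite PZ !DZ PD !PZ scalerBr opprD addrACA subrr add0r.
have cB j X Y : c j (X - Y) = c j X - c j Y.
  by rewrite /c coframeD -scaleN1r coframeZ mulN1r.
have wt : w * t = \sum_j c j (Phi (F j)).
  by apply: sfunP => q; rewrite evM tE (trace_frame B (oE q) eP) ev_sum.
pose be j X : C := (X0 (c j X) : C) - c j (D X).
have tbe j : tensorial (be j).
  split=> [X Y|a X]; rewrite /be /c.
    by rewrite DD !coframeD vf_add opprD addrACA.
  by rewrite DZ coframeD !coframeZ vf_leibniz; ring.
have beF j i : be j (F i) = (j == i)%:R * (X0 w : C) - c j (D (F i)).
  rewrite /be /c coframe_frame; case: (j == i); first by rewrite !mul1r.
  by rewrite !mul0r vf0.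
pose S := \sum_j \sum_i c i (Phi (F j)) * c j (D (F i)).
have S1 : w * (\sum_j be j (Phi (F j))) = (X0 w : C) * (w * t) - S.
  rewrite mulr_sumr wt mulr_sumr -sumrB; apply: eq_bigr => j _.
  rewrite (tensorial_expand B _ (tbe j)).
  under eq_bigr do rewrite beF mulrBr.
  rewrite sumrB (bigD1 j) //= eqxx mul1r big1 ?addr0 => [|i ij].
    by rewrite mulrC.
  by rewrite eq_sym (negbTE ij) mul0r mulr0.
have S2 : w * (\sum_j c j (Phi (D (F j)))) = S.
  rewrite mulr_sumr /S exchange_big; apply: eq_bigr => j _ /=.
  rewrite -[c j _]/((coframe B j \o Phi) (D (F j))).
  rewrite (tensorial_expand B _ (tensorial_endo (tensorial_coframe B j) eP)).
  by apply: eq_bigr => i _; rewrite mulrC.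
have key : w * (w * (X0 t : C)) = w * (\sum_j c j (Psi (F j))).
  have E1 : (X0 w : C) * t + w * (X0 t : C) =
      \sum_j be j (Phi (F j)) + \sum_j c j (D (Phi (F j))).
    rewrite -vf_leibniz wt vf_sum -big_split; apply: eq_bigr => j _ /=.
    by rewrite /be subrK.
  have -> : \sum_j c j (Psi (F j)) =
      \sum_j c j (D (Phi (F j))) - \sum_j c j (Phi (D (F j))).
    by rewrite -sumrB; apply: eq_bigr => j _; rewrite /Psi cB.
  have -> : w * (X0 t : C) = \sum_j be j (Phi (F j)) + \sum_j c j (D (Phi (F j))) -
     (X0 w : C) * t by rewrite -E1 addrC addKr.
  by rewrite mulrBr mulrDr S1 mulrBr S2; ring.
have := congr1 (fun u : C => u p) key; rewrite !evM => /(mulfI wp).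
rewrite ev_sum -(trace_frame B (oE p) ePsi) => /(mulfI wp) ->.
by [].
Qed.

End Traces.

(** * Curvature identities *)

Section Connection.
Context {R : realType} {n : nat} {M : smoothManifold R n}.
Local Notation C := (smooth_fun M).
Local Notation VF := (vector_field M).
Variables (g : riemannian_metric M) (nabla : affine_connection M).
Hypothesis LC : levi_civita g nabla.
Implicit Types X Y Z W U : VF.

Lemma bracketE X Y (f : C) : bracket X Y f = (X (Y f) - Y (X f) : C).
Proof. by []. Qed.

Lemma bracketDr X Y Z : bracket X (Y + Z) = bracket X Y + bracket X Z.
Proof.
by apply: vfunP => f; rewrite vfunD !bracketE !vfunD vf_add; ring.
Qed.

Lemma bracketNr X Y : bracket X (- Y) = - bracket X Y.
Proof. by apply: vfunP => f; rewrite vfunN !bracketE !vfunN vfN; ring. Qed.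

Lemma bracketZr X (a : C) Y : bracket X (a *: Y) = (X a : C) *: Y + a *: bracket X Y.
Proof.
apply: vfunP => f; rewrite vfunD !vfunZ !bracketE !vfunZ vf_leibniz; ring.
Qed.

Lemma bracketC X Y : bracket X Y = - bracket Y X.
Proof. by apply: vfunP => f; rewrite vfunN !bracketE; ring. Qed.

Lemma bracketDl X Y Z : bracket (X + Y) Z = bracket X Z + bracket Y Z.
Proof. by rewrite bracketC bracketDr opprD -!(bracketC _ Z). Qed.

Lemma jacobi X Y Z :
  bracket X (bracket Y Z) = bracket (bracket X Y) Z + bracket Y (bracket X Z).
Proof.
by apply: vfunP => f; rewrite vfunD !bracketE ?vf_sub; ring.
Qed.

Lemma connNl X Y : nabla (- X) Y = - nabla X Y.
Proof. by rewrite -scaleN1r connZl scaleN1r. Qed.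

Lemma conn0r X : nabla X 0 = 0.
Proof. by apply: (addrI (nabla X 0)); rewrite -connDr !addr0. Qed.

Lemma connNr X Y : nabla X (- Y) = - nabla X Y.
Proof. by apply: (addrI (nabla X Y)); rewrite -connDr !subrr conn0r. Qed.

Lemma torsion_free X Y : bracket X Y = nabla X Y - nabla Y X.
Proof. by rewrite LC.1. Qed.

Lemma compatible X Y Z : X (g Y Z) = (g (nabla X Y) Z + g Y (nabla X Z) : C).
Proof. exact: LC.2. Qed.

Notation Rm := (curvature nabla).

Lemma curvatureDl X Y Z W : Rm (X + Y) Z W = Rm X Z W + Rm Y Z W.
Proof.
rewrite /curvature bracketDl !connDl connDr.
by apply: vfunP => f; rewrite !(vfunD, vfunN); ring.
Qed.

Lemma curvatureZl (a : C) X Y Z : Rm (a *: X) Y Z = a *: Rm X Y Z.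
Proof.
rewrite /curvature !connZl connZr (bracketC (a *: X)) bracketZr connNl connDl !connZl.
rewrite (bracketC Y) connNl.
by apply: vfunP => f; rewrite !(vfunD, vfunN, vfunZ); ring.
Qed.

Lemma curvature_endo Y Z : endo (fun X => Rm X Y Z).
Proof. by split=> [X X'|a X]; [exact: curvatureDl|exact: curvatureZl]. Qed.

Lemma curvatureC X Y Z : Rm X Y Z = - Rm Y X Z.
Proof.
rewrite /curvature (bracketC X) connNl.
by apply: vfunP => f; rewrite !(vfunD, vfunN); ring.
Qed.

(** The bracket of X and Y acts on the function g Z W as a commutator, and nabla
    is compatible with g. *)
Lemma curvature_skew X Y Z W : g (Rm X Y Z) W = - g (Rm X Y W) Z.
Proof.
have := congr1 (fun V : VF => (V (g Z W) : C)) (erefl (bracket X Y)).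
rewrite {1}bracketE !compatible !vf_add !compatible => E.
rewrite /curvature !(metricDl, metricNl) !(metricC g _ Z).
apply/eqP; rewrite -subr_eq0; apply/eqP.
transitivity (g (nabla X (nabla Y Z)) W + g (nabla Y Z) (nabla X W) +
  (g (nabla X Z) (nabla Y W) + g Z (nabla X (nabla Y W))) -
  (g (nabla Y (nabla X Z)) W + g (nabla X Z) (nabla Y W) +
   (g (nabla Y Z) (nabla X W) + g Z (nabla Y (nabla X W)))) -
  (g (nabla (bracket X Y) Z) W + g Z (nabla (bracket X Y) W))); first by ring.
by rewrite E subrr.
Qed.

Lemma curvatureE X Y Z : Rm X Y Z =
  nabla X (nabla Y Z) - nabla Y (nabla X Z) - nabla (bracket X Y) Z.
Proof. by []. Qed.

Definition nabla_curvature W X Y Z : VF :=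
  nabla W (Rm X Y Z) - Rm (nabla W X) Y Z - Rm X (nabla W Y) Z - Rm X Y (nabla W Z).

Lemma nabla_curvature_skew W X Y Z U :
  g (nabla_curvature W X Y Z) U = - g (nabla_curvature W X Y U) Z.
Proof.
rewrite /nabla_curvature; have := curvature_skew.
move: (curvature nabla) => Q skew.
have E : (W (g (Q X Y Z) U) : C) = - (W (g (Q X Y U) Z) : C) by rewrite skew vfN.
rewrite !compatible in E; rewrite !(metricDl, metricNl).
rewrite (skew (nabla W X)) (skew X (nabla W Y)).
rewrite (skew _ _ (nabla W Z)) (skew _ _ (nabla W U)).
have -> : g (nabla W (Q X Y Z)) U = - (g (nabla W (Q X Y U)) Z +
  g (Q X Y U) (nabla W Z)) - g (Q X Y Z) (nabla W U) by rewrite -E addrK.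
ring.
Qed.

Lemma nabla_curvatureC W X Y Z : nabla_curvature W X Y Z = - nabla_curvature W Y X Z.
Proof.
rewrite /nabla_curvature; have := curvatureC; move: (curvature nabla) => Q QC.
rewrite (QC X Y) (QC (nabla W X)) (QC X (nabla W Y)) (QC X Y) connNr.
by apply: vfunP => f; rewrite !(vfunD, vfunN); ring.
Qed.

(** As nabla is torsion free, the terms in nabla_W X and nabla_X W combine to one
    in [W, X]; what remains cancels by the Jacobi identity. *)
Lemma bianchi2 W X Y Z :
  nabla_curvature W X Y Z + nabla_curvature X Y W Z + nabla_curvature Y W X Z = 0.
Proof.
have T A B D : Rm (bracket A B) D Z = Rm (nabla A B) D Z - Rm (nabla B A) D Z.
  by rewrite torsion_free curvatureDl -scaleN1r curvatureZl scaleN1r.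
transitivity (nabla W (Rm X Y Z) + nabla X (Rm Y W Z) + nabla Y (Rm W X Z)
  - (Rm X Y (nabla W Z) + Rm Y W (nabla X Z) + Rm W X (nabla Y Z))
  - (Rm (bracket W X) Y Z + Rm (bracket X Y) W Z + Rm (bracket Y W) X Z)).
  rewrite !T /nabla_curvature (curvatureC X (nabla W Y)) (curvatureC Y (nabla X W)).
  rewrite (curvatureC W (nabla Y X)).
  by apply: vfunP => f; rewrite !(vfunD, vfunN); ring.
have J : nabla (bracket (bracket Y W) X) Z = - nabla (bracket (bracket W X) Y) Z
    - nabla (bracket (bracket X Y) W) Z.
  rewrite -!connNl -connDl; congr (nabla _ Z).
  by apply: vfunP => f; rewrite !(vfunD, vfunN) !bracketE !vf_sub; ring.
rewrite !curvatureE J !(connDr, connNr).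
by apply: vfunP => f; rewrite !(vfunD, vfunN) vfun0; ring.
Qed.

Lemma lie_metricE xi X Y :
  lie_metric g xi X Y = g (nabla X xi) Y + g X (nabla Y xi).
Proof.
rewrite /lie_metric compatible !torsion_free !(metricDl, metricNl, metricDr, metricNr).
ring.
Qed.

(** Up to curvature, L_xi nabla is the second covariant derivative of xi. *)
Lemma lie_connectionE xi X Y : lie_connection nabla xi X Y =
  Rm xi X Y + nabla X (nabla Y xi) - nabla (nabla X Y) xi.
Proof.
rewrite /lie_connection curvatureE (torsion_free xi (nabla X Y)) (torsion_free xi Y).
rewrite connDr connNr.
by apply: vfunP => f; rewrite !(vfunD, vfunN); ring.
Qed.

(** The curvature terms of lie_connectionE cancel because the curvature is
    skew, which leaves the covariant derivative of L_xi g. *)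
Lemma nabla_lie_metric xi X Y Z :
  (X (lie_metric g xi Y Z) : C) - lie_metric g xi (nabla X Y) Z
    - lie_metric g xi Y (nabla X Z) =
  g (lie_connection nabla xi X Y) Z + g Y (lie_connection nabla xi X Z).
Proof.
rewrite !lie_metricE vf_add !compatible !lie_connectionE.
have := curvature_skew; move: (curvature nabla) => Q skew.
rewrite !(metricDl, metricNl, metricDr, metricNr).
rewrite (skew xi X Y) (metricC g Y (Q _ _ _)).
ring.
Qed.

Definition lie_curvature xi X Y Z : VF :=
  bracket xi (Rm X Y Z) - Rm (bracket xi X) Y Z - Rm X (bracket xi Y) Z
    - Rm X Y (bracket xi Z).

(** The Lie derivative of the curvature is the exterior covariant derivative of
    L_xi nabla: L_xi is commuted with [nabla_X, nabla_Y] - nabla_[X, Y]. *)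
Lemma lie_curvatureE xi X Y Z (A := lie_connection nabla xi) :
  lie_curvature xi X Y Z =
  nabla X (A Y Z) - A Y (nabla X Z) - nabla Y (A X Z) + A X (nabla Y Z)
    - A (bracket X Y) Z.
Proof.
rewrite /lie_curvature /A /lie_connection !curvatureE (jacobi xi X Y).
rewrite !(bracketDr, bracketNr, connDr, connNr, connDl).
by apply: vfunP => f; rewrite !(vfunD, vfunN); ring.
Qed.

Section ConformalAffine.
Variables (xi N : VF) (rho : C).
Hypothesis gradN : is_gradient g rho N.
Hypothesis LxiN : forall X Y, lie_connection nabla xi X Y =
  (X rho : C) *: Y + (Y rho : C) *: X - g X Y *: N.

Definition hess Y Z : C := g (nabla Y N) Z.

Lemma hessE Y Z : hess Y Z = (Y (Z rho) : C) - (nabla Y Z rho : C).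
Proof. by rewrite -!gradN compatible addrK. Qed.

(** The terms of lie_curvatureE in the first derivatives of rho cancel, since nabla
    is torsion free and compatible with g. *)
Lemma lie_curvature_conformal X Y Z : lie_curvature xi X Y Z =
  hess X Z *: Y - hess Y Z *: X - g Y Z *: nabla X N + g X Z *: nabla Y N.
Proof.
rewrite lie_curvatureE !LxiN !torsion_free.
rewrite !(connDr, connNr) !connZr !compatible !hessE.
have E := bracketE X Y rho; rewrite torsion_free vfunD vfunN in E.
apply: vfunP => f.
rewrite !(vfunD, vfunN, vfunZ) !(metricDl, metricNl).
have -> : (nabla X Y rho : C) = (X (Y rho) : C) - (Y (X rho) : C) + (nabla Y X rho : C).
  by rewrite -E subrK.
ring.
Qed.

End ConformalAffine.

End Connection.

(** * Almost Ricci solitons with an affine conformal Killing field *)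

Section Soliton.
Context {R : realType} {n : nat} {M : smoothManifold R n}.
Local Notation C := (smooth_fun M).
Local Notation VF := (vector_field M).
Variables (g : riemannian_metric M) (nabla : affine_connection M).
Hypothesis LC : levi_civita g nabla.
Hypothesis n2 : (2 < n)%N.
Variables (xi : VF) (lam rho : C) (N : VF).
Hypothesis hsol : almost_ricci_soliton g nabla xi lam.
Hypothesis gradN : is_gradient g rho N.
Hypothesis LxiN : forall X Y, lie_connection nabla xi X Y =
  (X rho : C) *: Y + (Y rho : C) *: X - g X Y *: N.
Hypothesis oE : forall q, orthonormal_at g q (onb g q).
Implicit Types (X Y Z W : VF) (p q : M).

Local Notation E := (onb g).
Local Notation Rm := (curvature nabla).
Local Notation h := (lie_metric g xi).
Local Notation hess := (hess g nabla N).

Let sum_ord_const (a : R) : \sum_(k < n) a = n%:R * a.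
Proof. by rewrite sumr_const card_ord mulr_natl. Qed.

(** The Ricci tensor.  The values of ricci are traces in frames that depend on the
    point without any regularity; by the soliton equation they agree with this
    smooth expression. *)
Definition soliton_ricci Y Z : C :=
  locked (lam * g Y Z - sfun_cst M (2^-1) * h Y Z).
Local Notation S := soliton_ricci.

Lemma soliton_ricciD Y Z : S Y Z = lam * g Y Z - sfun_cst M (2^-1) * h Y Z.
Proof. by rewrite /S -lock. Qed.

Lemma soliton_ricci_at Y Z q : S Y Z q = lam q * g Y Z q - 2^-1 * h Y Z q.
Proof. by rewrite soliton_ricciD. Qed.

Lemma soliton_ricciE Y Z q : S Y Z q = ricci g nabla Y Z q.
Proof.
by rewrite soliton_ricci_at -hsol addrC addKr.
Qed.

Lemma tensorial_lie_metricl Z : tensorial (h ^~ Z).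
Proof.
split=> [X Y|a X]; rewrite !(lie_metricE LC).
  by rewrite connDl !metricDl; ring.
by rewrite connZl !metricZl; ring.
Qed.

Lemma lie_metricC X Y : h X Y = h Y X.
Proof. by rewrite !(lie_metricE LC) addrC (metricC g X) (metricC g (nabla X xi)). Qed.

Lemma soliton_ricciC X Y : S X Y = S Y X.
Proof. by rewrite !soliton_ricciD lie_metricC metricC. Qed.

Lemma tensorial_riccil Z : tensorial (S ^~ Z).
Proof.
have [hD hZ] := tensorial_lie_metricl Z.
split=> [X Y|a X]; rewrite !soliton_ricciD.
  by rewrite hD metricDl; ring.
by rewrite hZ metricZl; ring.
Qed.

Lemma tensorial_riccir Y : tensorial (S Y).
Proof.
have [SD SZ] := tensorial_riccil Y.
by split=> [X Z|a X]; rewrite ![S Y _]soliton_ricciC; [exact: SD|exact: SZ].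
Qed.

(** The covariant derivative of L_xi g = 2 (lam g - Ric) is 2 d rho (x) g by
    nabla_lie_metric. *)
Lemma nabla_ricci X Y Z :
  (X (S Y Z) : C) - S (nabla X Y) Z - S Y (nabla X Z) = (X (lam - rho) : C) * g Y Z.
Proof.
have := nabla_lie_metric LC xi X Y Z.
rewrite !LxiN !(metricDl, metricNl, metricDr, metricNr) !metricZl !metricZr.
rewrite (gradN Z) (metricC g Y N) (gradN Y) => H.
rewrite !soliton_ricciD (vf_sub X (_ * _)) (vf_cst X (2^-1)) vf_leibniz.
rewrite (vf_sub X lam) (compatible LC).
move: (h Y Z) (h (nabla X Y) Z) (h Y (nabla X Z)) H => h1 h2 h3 H.
apply: sfunP => q; have {H} := congr1 (fun u : C => u q) H.
rewrite !(evD, evB, evM, evN) => H.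
have -> : (sfun_cst M (2^-1)) q = 2^-1 by [].
rewrite (metricC g Y X) in H; lra.
Qed.

(** derive_trace for the derivation nabla_W. *)
Lemma trace_nabla_curvature W Y Z p :
  \sum_i g (nabla_curvature nabla W (E p i) Y Z) (E p i) p =
  ((W (S Y Z) : C) - S (nabla W Y) Z - S Y (nabla W Z)) p.
Proof.
have Sr A B q : S A B q = \sum_i g (Rm (E q i) A B) (E q i) q by rewrite soliton_ricciE.
have := @derive_trace _ _ _ g E (fun V => Rm V Y Z) (nabla W) W (S Y Z) p oE
  (curvature_endo nabla Y Z) (connDr nabla W) (fun a V => connZr nabla a W V) (Sr Y Z).
rewrite !evB => ->; rewrite !Sr -!sumrB; apply: eq_bigr => i _.
rewrite /nabla_curvature; move: (curvature nabla) => Q.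
by rewrite !metricDl !metricNl !(evD, evN).
Qed.

(** By nabla_ricci, the contractions of nabla Rm in the second Bianchi identity
    are multiples of df, where f = lam - rho; contracted once more, the identity
    reads n df - df - df = 0. *)
Lemma derive_lam_rho W : (W (lam - rho) : C) = 0.
Proof.
apply: sfunP => p; set f := lam - rho.
have tf : tensorial (fun X : VF => (X f : C)).
  by split=> [X Y|a X]; [exact: vfunD|exact: vfunZ].
have tr1 V A B : \sum_i g (nabla_curvature nabla V (E p i) A B) (E p i) p =
    (V f : C) p * g A B p by rewrite trace_nabla_curvature nabla_ricci.
have P k : \sum_i g (nabla_curvature nabla W (E p i) (E p k) (E p k)) (E p i) p +
    \sum_i g (nabla_curvature nabla (E p i) (E p k) W (E p k)) (E p i) p -
    \sum_i g (nabla_curvature nabla (E p k) (E p i) W (E p k)) (E p i) p = 0.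
  rewrite -big_split -sumrB; apply: big1 => i _.
  have := bianchi2 LC W (E p i) (E p k) (E p k).
  move=> /(congr1 (fun V => g V (E p i) p)).
  rewrite (nabla_curvatureC nabla (E p k) W).
  by rewrite !(metricDl, metricNl) -(scale0r 0) metricZl mul0r.
have Q : \sum_k \sum_i g (nabla_curvature nabla (E p i) (E p k) W (E p k)) (E p i) p
    = - (W f : C) p.
  rewrite exchange_big.
  rewrite (parseval W (oE p) tf) -sumrN; apply: eq_bigr => i _.
  rewrite mulrC.
  rewrite -tr1 -sumrN; apply: eq_bigr => k _.
  by rewrite (nabla_curvature_skew LC).
have H k : ((W f : C) p - (E p k f : C) p * g W (E p k) p) +
    \sum_i g (nabla_curvature nabla (E p i) (E p k) W (E p k)) (E p i) p = 0.
  have := P k; rewrite (tr1 W (E p k) (E p k)) (tr1 (E p k) W (E p k)) oE eqxx mulr1.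
  by move=> H0; rewrite -[RHS]H0 addrAC.
have : \sum_k ((W f : C) p - (E p k f : C) p * g W (E p k) p) +
    \sum_k \sum_i g (nabla_curvature nabla (E p i) (E p k) W (E p k)) (E p i) p = 0.
  by rewrite -big_split; apply: big1 => k _; exact: H.
rewrite Q sumrB sum_ord_const.
rewrite (eq_bigr (fun k => g W (E p k) p * (E p k f : C) p)); last first.
  by move=> k _; rewrite mulrC.
rewrite -(parseval W (oE p) tf) => Htot.
have n20 : (n%:R - 2 : R) != 0 by rewrite subr_eq0 eqr_nat gtn_eqF.
by apply: (mulfI n20); rewrite ev0 mulr0 -Htot; ring.
Qed.

Lemma derive_rho X : (X rho : C) = (X lam : C).
Proof.
by have := derive_lam_rho X; rewrite vf_sub => /eqP; rewrite subr_eq0 => /eqP.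
Qed.

Lemma ricci_parallel X Y Z : X (S Y Z) = (S (nabla X Y) Z + S Y (nabla X Z) : C).
Proof.
have := nabla_ricci X Y Z; rewrite derive_lam_rho mul0r => H.
by rewrite -[LHS](subrK (S (nabla X Y) Z)) -[X in X + _](subrK (S Y (nabla X Z))) H; ring.
Qed.

Definition laplacian p : R := \sum_i hess (E p i) (E p i) p.

Lemma tensorial_hessr Y : tensorial (hess Y).
Proof. exact: tensorial_metricr. Qed.

Lemma tensorial_hessl Z : tensorial (hess ^~ Z).
Proof.
by split=> [X Y|a X]; rewrite /hess ?connDl ?connZl ?metricDl ?metricZl.
Qed.

(** The trace of lie_curvature_conformal.  On the left, derive_trace for L_xi gives
    L_xi S, and nabla_xi S = 0 turns it into the derivatives of xi. *)
Lemma lie_ricci Y Z p : (S (nabla Y xi) Z + S Y (nabla Z xi)) p =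
  - (n%:R - 2) * hess Y Z p - laplacian p * g Y Z p.
Proof.
have Sr A B q : S A B q = \sum_i g (Rm (E q i) A B) (E q i) q by rewrite soliton_ricciE.
have := @derive_trace _ _ _ g E (fun V => Rm V Y Z) (bracket xi) xi (S Y Z) p oE
  (curvature_endo nabla Y Z) (bracketDr xi) (fun a V => bracketZr xi a V) (Sr Y Z).
move=> D.
have L : \sum_i g (lie_curvature nabla xi (E p i) Y Z) (E p i) p =
    ((xi (S Y Z) : C) - S (bracket xi Y) Z - S Y (bracket xi Z)) p.
  rewrite !evB D !Sr -!sumrB; apply: eq_bigr => i _.
  rewrite /lie_curvature; move: (curvature nabla) => Q.
  by rewrite !metricDl !metricNl !(evD, evN).
have {D} := L; rewrite ricci_parallel !(torsion_free LC).
rewrite (tensorial_riccil Z).1 (tensorial_riccir Y).1.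
have SNl A B : S (- A) B = - S A B.
  by rewrite -scaleN1r (tensorial_riccil B).2 mulN1r.
have SNr A B : S A (- B) = - S A B by rewrite soliton_ricciC SNl soliton_ricciC.
rewrite SNl SNr => L2.
transitivity ((S (nabla xi Y) Z + S Y (nabla xi Z) - (S (nabla xi Y) Z - S (nabla Y xi) Z) -
  (S Y (nabla xi Z) - S Y (nabla Z xi))) p); 
    first by apply: (congr1 (fun u : C => u p)); ring.
rewrite -L2.
under eq_bigr do rewrite (lie_curvature_conformal LC gradN LxiN)
  !(metricDl, metricNl) !metricZl !(evD, evN) !evM.
rewrite !big_split !sumrN /=.
have -> : \sum_i hess (E p i) Z p * g Y (E p i) p = hess Y Z p.
  rewrite (parseval Y (oE p) (tensorial_hessl Z)).
  by apply: eq_bigr => i _; rewrite mulrC.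
have -> : \sum_i hess Y Z p * g (E p i) (E p i) p = n%:R * hess Y Z p.
  under eq_bigr do rewrite oE eqxx mulr1.
  by rewrite sum_ord_const.
have -> : \sum_i g Y Z p * g (nabla (E p i) N) (E p i) p = laplacian p * g Y Z p.
  by rewrite -mulr_sumr mulrC.
have -> : \sum_i g (E p i) Z p * g (nabla Y N) (E p i) p = hess Y Z p.
  rewrite (parseval Z (oE p) (tensorial_hessr Y)).
  by apply: eq_bigr => i _; rewrite (metricC g Z).
ring.
Qed.

Local Notation s := (scalar_curvature g nabla).

Lemma scalar_curvatureE p : s p = \sum_k S (E p k) (E p k) p.
Proof. by apply: eq_bigr => k _; rewrite soliton_ricciE. Qed.

(** The trace of lie_ricci: since S is symmetric, the left-hand side becomes the
    inner product of S with L_xi g = 2 (lam g - S). *)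
Lemma norm_ricci p :
  \sum_k \sum_l S (E p k) (E p l) p ^+ 2 = lam p * s p + (n%:R - 1) * laplacian p.
Proof.
pose b k l := g (nabla (E p k) xi) (E p l) p.
pose S' k l := S (E p k) (E p l) p.
have S'C k l : S' k l = S' l k by rewrite /S' soliton_ricciC.
have S'E k l : S' k l = lam p * (k == l)%:R - 2^-1 * (b k l + b l k).
  rewrite /S' soliton_ricci_at oE (lie_metricE LC) evD /b.
  by rewrite (metricC g (E p k) (nabla _ _)).
have tr k : \sum_l b k l * S' k l = S (nabla (E p k) xi) (E p k) p.
  rewrite (parseval _ (oE p) (tensorial_riccil (E p k))).
  by apply: eq_bigr => l _; rewrite S'C.
have T : 2 * \sum_k \sum_l b k l * S' k l = - (2 * (n%:R - 1)) * laplacian p.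
  transitivity (\sum_k (S (nabla (E p k) xi) (E p k) + S (E p k) (nabla (E p k) xi)) p).
    rewrite mulr_sumr; apply: eq_bigr => k _.
    by rewrite tr evD (soliton_ricciC (E p k)) mulrC mulr_natr mulr2n.
  under eq_bigr do rewrite lie_ricci oE eqxx mulr1.
  rewrite sumrB -mulr_sumr -/(laplacian p) sum_ord_const; ring.
have T2 : \sum_k \sum_l b k l * S' k l = \sum_k \sum_l 2^-1 * (b k l + b l k) * S' k l.
  have H : \sum_k \sum_l b k l * S' k l = \sum_k \sum_l b l k * S' k l.
    by rewrite exchange_big; apply: eq_bigr => k _; apply: eq_bigr => l _; rewrite S'C.
  have -> : \sum_k \sum_l 2^-1 * (b k l + b l k) * S' k l =
     2^-1 * \sum_k \sum_l b k l * S' k l + 2^-1 * \sum_k \sum_l b l k * S' k l.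
    rewrite !mulr_sumr -big_split; apply: eq_bigr => k _ /=.
    by rewrite !mulr_sumr -big_split; apply: eq_bigr => l _ /=; ring.
  by rewrite -H; lra.
have T3 : \sum_k \sum_l S' k l ^+ 2 = lam p * s p -
    \sum_k \sum_l 2^-1 * (b k l + b l k) * S' k l.
  rewrite scalar_curvatureE mulr_sumr -sumrB; apply: eq_bigr => k _.
  rewrite -/(S' k k).
  transitivity (\sum_l (lam p * ((k == l)%:R * S' k l) - 2^-1 * (b k l + b l k) * S' k l)).
    by apply: eq_bigr => l _; rewrite expr2 {1}S'E; ring.
  rewrite sumrB -mulr_sumr (bigD1 k) //= eqxx mul1r big1 ?addr0 // => l lk.
  by rewrite eq_sym (negbTE lk) mul0r.
by rewrite T3 -T2; lra.
Qed.

Hypothesis snz : forall p, s p != 0.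
Hypothesis hle : forall p, s p * (n%:R * lam p - s p) <= 0.

Let n_gt0 : 0 < n%:R :> R. Proof. by rewrite ltr0n (leq_ltn_trans _ n2). Qed.

(** At a maximum of lam the Laplacian of rho is nonpositive, so that
    |S|^2 <= lam s <= s^2 / n, and the trace-free part of S has norm 0. *)
Lemma einstein_at_max p : (forall q, lam q <= lam p) ->
  forall Y Z, S Y Z p = lam p * g Y Z p.
Proof.
move=> pmax.
have lap : laplacian p <= 0.
  apply: sumr_le0 => i _; rewrite (hessE LC gradN) !derive_rho evB.
  have [_ le] := maximum_conditions pmax (E p i).
  by have [-> _] := maximum_conditions pmax (nabla (E p i) (E p i)); rewrite subr0.
pose S' k l := S (E p k) (E p l) p.
pose m := s p / n%:R.
have sm : s p = n%:R * m by rewrite /m mulrC divfK // gt_eqF.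
have m0 : m != 0 by rewrite mulf_neq0 // invr_eq0 gt_eqF.
have dev : \sum_k \sum_l (S' k l - m * (k == l)%:R) ^+ 2 =
    \sum_k \sum_l S' k l ^+ 2 - n%:R * m ^+ 2.
  transitivity (\sum_k (\sum_l S' k l ^+ 2 - (2 * m * S' k k - m ^+ 2))).
    apply: eq_bigr => k _; apply/eqP; rewrite -subr_eq0 opprB addrCA -sumrB.
    rewrite (bigD1 k) //= eqxx big1 => [|l lk]; last first.
      by rewrite eq_sym (negbTE lk) mulr0 subr0 subrr.
    by apply/eqP; rewrite mulr1; ring.
  rewrite sumrB; congr (_ - _).
  rewrite sumrB -mulr_sumr -scalar_curvatureE sum_ord_const sm; ring.
have le1 : \sum_k \sum_l S' k l ^+ 2 <= lam p * s p.
  rewrite norm_ricci gerDl mulr_ge0_le0 // subr_ge0 (_ : 1 = 1%:R) // ler_nat.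
  exact: leq_ltn_trans n2.
have le2 : lam p * s p <= n%:R * m ^+ 2.
  have := hle p; rewrite sm => H.
  have : n%:R * (lam p * (n%:R * m)) <= n%:R * (n%:R * m ^+ 2) by nra.
  by rewrite ler_pM2l.
have dev_ge0 k l : 0 <= (S' k l - m * (k == l)%:R) ^+ 2 by exact: sqr_ge0.
have dev0 : \sum_k \sum_l (S' k l - m * (k == l)%:R) ^+ 2 = 0.
  apply/eqP; rewrite eq_le; apply/andP; split; first by rewrite dev subr_le0; exact: le_trans le2.
  by apply: sumr_ge0 => k _; apply: sumr_ge0.
have Sm k l : S' k l = m * (k == l)%:R.
  move/eqP: dev0; rewrite psumr_eq0 => [/allP/(_ k (mem_index_enum _))|i _]; last exact: sumr_ge0.
  move=> /eqP/eqP; rewrite psumr_eq0 => [/allP/(_ l (mem_index_enum _))|//].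
  by rewrite /= sqrf_eq0 subr_eq0 => /eqP.
have lm : lam p = m.
  have A : \sum_k \sum_l S' k l ^+ 2 = n%:R * m ^+ 2.
    by apply/eqP; rewrite -subr_eq0 -dev dev0.
  have B : lam p * s p = n%:R * m ^+ 2 by apply/eqP; rewrite eq_le le2 -A le1.
  have nm : n%:R * m != 0 by rewrite -sm.
  by apply: (mulIf nm); rewrite -{1}sm B; ring.
move=> Y Z.
rewrite (parseval Y (oE p) (tensorial_riccil Z)) (parseval Y (oE p) (tensorial_metricl g Z)).
rewrite mulr_sumr; apply: eq_bigr => k _; rewrite mulrCA; congr (_ * _).
rewrite (parseval Z (oE p) (tensorial_riccir _)) (parseval Z (oE p) (tensorial_metricr g _)).
rewrite mulr_sumr; apply: eq_bigr => l _; rewrite mulrCA; congr (_ * _).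
by rewrite -/(S' k l) Sm oE lm.
Qed.

Hypothesis cM : connected [set: M].

(** The tensor S - lam(p) g is parallel and vanishes at p. *)
Lemma einstein p : (forall q, lam q <= lam p) ->
  forall Y Z, S Y Z = sfun_cst M (lam p) * g Y Z.
Proof.
move=> pmax Y Z; apply: sfunP => q; pose c := sfun_cst M (lam p).
pose T A B := S A B - c * g A B.
apply/eqP; rewrite -subr_eq0 -evB -/(T Y Z); apply/eqP.
apply: (@parallel_vanish _ _ _ T nabla p cM) => [B|A|X A B|A B].
- have [SD SZ] := tensorial_riccil B.
  by split=> [X X'|a X]; rewrite /T ?SD ?SZ ?metricDl ?metricZl; ring.
- have [SD SZ] := tensorial_riccir A.
  by split=> [X X'|a X]; rewrite /T ?SD ?SZ ?metricDr ?metricZr; ring.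
- by rewrite /T /c vf_sub vf_cst ricci_parallel (compatible LC); ring.
- by rewrite /T evB evM einstein_at_max // subrr.
Qed.

Section Einstein.
Variable c : R.
Hypothesis SE : forall Y Z, S Y Z = sfun_cst M c * g Y Z.

Lemma einstein_scalar q : s q = n%:R * c.
Proof.
rewrite scalar_curvatureE; under eq_bigr do rewrite SE evM oE eqxx mulr1.
by rewrite sum_ord_const.
Qed.

Lemma einstein_lie_metric Y Z q : h Y Z q = 2 * (lam q - c) * g Y Z q.
Proof.
have := congr1 (fun u : C => u q) (SE Y Z); rewrite soliton_ricci_at evM.
have -> : (sfun_cst M c) q = c by [].
by move: (h Y Z q) => H ?; lra.
Qed.

(** The trace of lie_ricci eliminates the Laplacian.  With mu = c - lam this is
    Obata's equation Hess mu = - c / (n - 1) mu g. *)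
Lemma einstein_hess Y Z q : (n%:R - 1) * hess Y Z q = c * (c - lam q) * g Y Z q.
Proof.
have L A B : 2 * c * (lam q - c) * g A B q =
    - (n%:R - 2) * hess A B q - laplacian q * g A B q.
  rewrite -lie_ricci !SE -mulrDr evM -(lie_metricE LC) einstein_lie_metric.
  have -> : (sfun_cst M c) q = c by [].
  ring.
have T : 2 * c * (lam q - c) * n%:R = - (2 * (n%:R - 1)) * laplacian q.
  transitivity (\sum_k 2 * c * (lam q - c) * g (E q k) (E q k) q).
    under [RHS]eq_bigr do rewrite oE eqxx mulr1.
    by rewrite sum_ord_const mulrC.
  under eq_bigr do rewrite L oE eqxx mulr1.
  rewrite sumrB -mulr_sumr -/(laplacian q) sum_ord_const; ring.
have n20 : (n%:R - 2 : R) != 0 by rewrite subr_eq0 eqr_nat gtn_eqF.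
apply: (mulfI n20); have := L Y Z.
move: (hess Y Z q) (g Y Z q) (laplacian q) (lam q) T => H G D l T LL.
have -> : (n%:R - 2) * ((n%:R - 1) * H) =
   - (n%:R - 1) * (2 * c * (l - c) * G) - (n%:R - 1) * D * G by rewrite LL; ring.
have -> : (n%:R - 1) * D = - c * (l - c) * n%:R by lra.
ring.
Qed.

End Einstein.

End Soliton.

(** If there were no orthonormal family at p, the fields onb g p would all be zero,
    and so would the scalar curvature. *)
Lemma onb_orthonormal (R : realType) (n : nat) (M : smoothManifold R n)
    (g : riemannian_metric M) (nabla : affine_connection M) p :
  scalar_curvature g nabla p != 0 -> orthonormal_at g p (onb g p).
Proof.
move=> s0; rewrite /onb.
have [[E oE]|noE] := pselect (exists E, orthonormal_at g p E).
  exact: (@xgetPex _ (fun=> 0) [set E | orthonormal_at g p E] (ex_intro _ E oE)).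
have onb0 i : onb g p i = 0.
  rewrite /onb xgetPN // => E oE; apply: noE; by exists E.
case/eqP: s0; rewrite /scalar_curvature big1 // => i _; rewrite /ricci big1 // => j _.
by rewrite (onb0 j) -[X in g _ X](scale0r (0 : vector_field M)) metricZr mul0r.
Qed.

Lemma metric_eq0 (R : realType) (n : nat) (M : smoothManifold R n)
    (g : riemannian_metric M) (X : vector_field M) :
  (forall p, g X X p = 0) -> X = 0.
Proof.
move=> X0; apply: vfunP => f; apply: sfunP => p.
by rewrite (metric_definite (X0 p)).
Qed.

(** The tensor w g is parallel and vanishes at p. *)
Lemma constant_vanish (R : realType) (n : nat) (M : smoothManifold R n)
    (g : riemannian_metric M) (nabla : affine_connection M)
    (E : M -> 'I_n -> vector_field M) (w : smooth_fun M) p :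
  (0 < n)%N -> connected [set: M] -> levi_civita g nabla ->
  (forall q, orthonormal_at g q (E q)) ->
  (forall X : vector_field M, X w = 0) -> w p = 0 -> forall q, w q = 0.
Proof.
move=> n0 cM LC oE dw wp q; pose i := Ordinal n0.
have := @parallel_vanish _ _ _ (fun Y Z => w * g Y Z) nabla p cM.
have TP (X Y Z : vector_field M) :
    X (w * g Y Z) = (w * g (nabla X Y) Z + w * g Y (nabla X Z) : smooth_fun M).
  by rewrite vf_leibniz dw mul0r add0r (compatible LC) mulrDr.
move=> /(_ _ _ TP) => H.
have := H _ _ _ (E q i) (E q i) q; rewrite evM oE eqxx mulr1; apply.
- by move=> Z; split=> [X Y|a X]; rewrite ?metricDl ?metricZl; ring.
- by move=> Y; split=> [X Z|a X]; rewrite ?metricDr ?metricZr; ring.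
- by move=> Y Z; rewrite evM wp mul0r.
Qed.

Theorem proposition4p3 (R : realType) (n : nat) (hn : (2 < n)%N)
    (M : smoothManifold R n)
    (hcompact : compact [set: M]) (hconnected : connected [set: M])
    (g : riemannian_metric M) (nabla : affine_connection M)
    (hnabla : levi_civita g nabla)
    (xi : vector_field M) (lambda : smooth_fun M)
    (hsoliton : almost_ricci_soliton g nabla xi lambda)
    (hxi : affine_conformal_killing g nabla xi)
    (hr : forall p : M, scalar_curvature g nabla p != 0)
    (hle : forall p : M,
       scalar_curvature g nabla p *
         (n%:R * lambda p - scalar_curvature g nabla p) <= 0) :
  affine_killing nabla xi /\ trivial_ricci_soliton g nabla xi lambda.
Proof.
have [rho [N gradN LxiN]] := hxi.
have oE q : orthonormal_at g q (onb g q) by exact: onb_orthonormal (hr q).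
suff H : exists c : R, forall q, lambda q = c /\ (g N N q = 0 /\ forall Y Z,
    lie_metric g xi Y Z q = 0).
  have [c Hc] := H.
  have N0 : N = 0 by apply: (@metric_eq0 _ _ _ g) => q; have [_ []] := Hc q.
  have drho (X : vector_field M) : (X rho : smooth_fun M) = 0.
    by rewrite -gradN N0 -(scale0r 0) metricZl mul0r.
  split; first by move=> X Y; rewrite LxiN !drho N0 !scale0r scaler0 subr0 addr0.
  split; first by split=> //; exists c => q; have [] := Hc q.
  by move=> X Y; apply: sfunP => q; have [_ [_ ->]] := Hc q.
have [[p0 _]|M0] := pselect (exists p : M, True); last first.
  by exists 0 => q; case: M0; exists q.
have [||| p _ pmax0] := @compact_EVT_max M R lambda setT.
- by exists p0.
- exact: hcompact.
- by apply: continuous_subspaceT; exact: sfun_continuous.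
have pmax q : lambda q <= lambda p by apply: pmax0; rewrite inE.
pose c := lambda p; exists c.
have SE := einstein hnabla hn hsoliton gradN LxiN oE hr hle hconnected pmax.
have sE := einstein_scalar hsoliton oE SE.
have hE := einstein_lie_metric SE.
have HE := einstein_hess hnabla hn hsoliton gradN LxiN oE SE.
have drho := derive_rho hnabla hn hsoliton gradN LxiN oE.
have n0 : 0 < n%:R :> R by rewrite ltr0n (leq_ltn_trans _ hn).
have n1 : 0 < n%:R - 1 :> R by rewrite subr_gt0 (_ : 1 = 1%:R) // ltr_nat (ltn_trans _ hn).
pose k := c / (n%:R - 1).
pose mu := sfun_cst M c - lambda.
(* A first integral of Obata's equation. *)
pose w : smooth_fun M := g N N + sfun_cst M k * (mu * mu).
have hessE Y Z : g (nabla Y N) Z = sfun_cst M k * (mu * g Y Z).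
  apply: sfunP => q; apply: (mulfI (lt0r_neq0 n1)); rewrite [LHS]HE !evM.
  have -> : mu q = c - lambda q by [].
  have -> : sfun_cst M k q = c / (n%:R - 1) by [].
  rewrite -/c; field; exact: lt0r_neq0.
have dw (X : vector_field M) : (X w : smooth_fun M) = 0.
  rewrite /w vf_add vf_cst vf_leibniz (compatible hnabla) (metricC g N) hessE.
  rewrite /mu (vf_sub X _ lambda) vf_const -drho -gradN (metricC g X); ring.
have wp : w p = 0.
  have -> : w p = g N N p + k * ((c - lambda p) * (c - lambda p)) by [].
  rewrite subrr mulr0 mulr0 addr0 gradN drho.
  by have [] := maximum_conditions pmax N.
have w0 := constant_vanish (ltn_trans _ hn) hconnected hnabla oE dw wp.
move=> q.
have wq : g N N q + k * ((c - lambda q) * (c - lambda q)) = 0 by exact: w0.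
have lq : lambda q = c.
  have [c0|c0|c0] := ltgtP 0 c.
  - have k0 : 0 < k by rewrite divr_gt0.
    have N0 := metric_ge0 g N q.
    have S0 : 0 <= (c - lambda q) * (c - lambda q) by rewrite -expr2 sqr_ge0.
    have : k * ((c - lambda q) * (c - lambda q)) = 0.
      by apply/eqP; rewrite eq_le mulr_ge0 ?(ltW k0) // andbT; lra.
    move=> /eqP; rewrite mulf_eq0 gt_eqF //= mulf_eq0 orbb subr_eq0.
    by move=> /eqP.
  - have := hle q; rewrite sE -/c => H.
    apply/eqP; rewrite eq_le pmax /=.
    have : (n%:R * n%:R) * (c * (lambda q - c)) <= 0 by nra.
    by rewrite pmulr_rle0 ?mulr_gt0 // nmulr_rle0 // subr_ge0.
  - by have := hr q; rewrite sE -/c -c0 mulr0 eqxx.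
rewrite lq; split=> //; split.
  by move: wq; rewrite lq subrr mulr0 mulr0 addr0.
by move=> Y Z; rewrite hE -/c lq subrr mulr0 mul0r.
Qed.
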